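(* Let $P$ be an $n$-dimensional, simple polytope given by a minimal representation. All circuit walks in $P$ are edge walks if and only if $P$ is an $(n,d)$-parallelotope for some $d\in\{1,\dots,n\}$.
   Context: A polytope $P=\{x: Ax=b,\ Bx\le d\}$ ($A,B$ rational) is given by a minimal representation if every inequality defines a facet. $P$ is simple if each vertex lies in exactly $\dim P$ facets. Circuits: $\mathcal C(A,B)$ is the set of $g\in\ker(A)\setminus\{0\}$ with coprime integer components such that the support of $Bg$ is inclusion-minimal among supports of $Bx$, $x\in\ker(A)\setminus\{0\}$. A circuit walk between vertices $v^{(1)},v^{(2)}$ is a sequence $v^{(1)}=y^{(0)},\dots,y^{(k)}=v^{(2)}$ with $y^{(i)}\in P$, $y^{(i+1)}=y^{(i)}+\alpha_i g^{(i)}$ for some $g^{(i)}\in\mathcal C(A,B)$, $\alpha_i>0$, and $y^{(i)}+\alpha g^{(i)}\notin P$ for all $\alpha>\alpha_i$; it is an edge walk if each $y^{(i)}$ is a vertex and each $[y^{(i)},y^{(i+1)}]$ is an edge of $P$. For vertices $u,v$, $P^{uv}$ is the inclusion-minimal face containing both, and $I^{uv}(u)=\{g: u+\varepsilon g\in P^{uv}\text{ for some }\varepsilon>0\}$. $P$ satisfies the symmetric inner cone condition if $I^{uv}(u)=-I^{uv}(v)$ for all pairs of vertices $u,v$. A $d$-parallelotope is a set $a+\{\sum_{i=1}^d\lambda_i w_i: \lambda_i\in[0,1]\}$ with $w_1,\dots,w_d$ linearly independent (a polytope with $d$ pairs of parallel opposite facets and $2^d$ vertices). For $d\in\{1,\dots,n\}$,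 an $(n,d)$-parallelotope is an $n$-dimensional polytope with $n+d$ facets that satisfies the symmetric inner cone condition and in which every vertex belongs to a face that is a $d$-parallelotope. *)

(* Defs.v *)
From mathcomp Require Import all_boot all_order all_algebra.
From mathcomp Require Import all_classical all_reals topology normedtype.

Set Implicit Arguments.
Unset Strict Implicit.
Unset Printing Implicit Defensive.

Import Order.TTheory GRing.Theory Num.Theory.
Import numFieldNormedType.Exports.
Local Open Scope classical_set_scope.
Local Open Scope card_scope.
Local Open Scope ring_scope.

Section Polyhedra.
Variables (R : realType) (N : nat).
Local Notation V := 'cV[R]_N.

Definition polyhedron (p m : nat) (A : 'M[R]_(p, N)) (b : 'cV[R]_p)
    (B : 'M[R]_(m, N)) (d : 'cV[R]_m) : set V :=
  [set x | A *m x = b /\ forall i, (B *m x) i 0 <= d i 0].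

Definition is_polytope (P : set V) : Prop :=
  bounded_set P /\
  exists (p m : nat) (A : 'M[R]_(p, N)) (b : 'cV[R]_p)
         (B : 'M[R]_(m, N)) (d : 'cV[R]_m), P = polyhedron A b B d.

(* [S] has affine dimension [k]: the points x0, x0 + X`_0, ..., x0 + X`_(k-1)
   of [S] form an affine basis of the affine hull of [S]. *)
Definition has_dim (S : set V) (k : nat) : Prop :=
  exists (x0 : V) (X : k.-tuple V),
    [/\ S x0, free X, forall i : 'I_k, S (x0 + tnth X i)
      & forall x, S x -> x - x0 \in <<X>>%VS].

(* Faces are cut out by valid inequalities; [P] itself (c = 0, delta = 0) is a
   face, and so is the empty set. *)
Definition is_face (P F : set V) : Prop :=
  exists (c : 'rV[R]_N) (delta : R),
    (forall x, P x -> (c *m x) 0 0 <= delta) /\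
    F = [set x | P x /\ (c *m x) 0 0 = delta].

Definition is_vertex (P : set V) (v : V) : Prop := is_face P [set v].

Definition is_edge (P E : set V) : Prop := is_face P E /\ has_dim E 1.

Definition is_facet (P F : set V) : Prop :=
  is_face P F /\ exists k, has_dim P k.+1 /\ has_dim F k.

Definition is_simple (P : set V) : Prop :=
  exists n, has_dim P n /\
    forall v, is_vertex P v -> [set F | is_facet P F /\ F v] #= `I_n.

Definition minimal_representation (p m : nat) (A : 'M[R]_(p, N))
    (b : 'cV[R]_p) (B : 'M[R]_(m, N)) (d : 'cV[R]_m) : Prop :=
  forall i : 'I_m, is_facet (polyhedron A b B d)
    [set x | polyhedron A b B d x /\ (B *m x) i 0 = d i 0].

Definition segment (y z : V) : set V :=
  [set x | exists2 t : R, 0 <= t <= 1 & x = (1 - t) *: y + t *: z].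

Definition supp (m : nat) (y : 'cV[R]_m) : {set 'I_m} :=
  [set i | y i 0 != 0]%SET.

Definition is_circuit (p m : nat) (A : 'M[rat]_(p, N)) (B : 'M[rat]_(m, N))
    (g : V) : Prop :=
  let AR : 'M[R]_(p, N) := map_mx ratr A in
  let BR : 'M[R]_(m, N) := map_mx ratr B in
  [/\ AR *m g = 0, g != 0,
      exists2 z : 'cV[int]_N,
        g = map_mx intr z & \big[gcdn/0%N]_(i < N) `|z i ord0|%N = 1%N
    & forall x : V, AR *m x = 0 -> x != 0 ->
        ~~ (supp (BR *m x) \proper supp (BR *m g))].

(* The walk is y 0, ..., y k; the values of [y] beyond [k] are irrelevant. *)
Definition circuit_walk (p m : nat) (A : 'M[rat]_(p, N)) (B : 'M[rat]_(m, N))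
    (P : set V) (v1 v2 : V) (k : nat) (y : nat -> V) : Prop :=
  [/\ is_vertex P v1 /\ is_vertex P v2, y 0%N = v1 /\ y k = v2,
      forall i, (i <= k)%N -> P (y i)
    & forall i, (i < k)%N -> exists (g : V) (alpha : R),
        [/\ is_circuit A B g, 0 < alpha, y i.+1 = y i + alpha *: g
          & forall alpha', alpha < alpha' -> ~ P (y i + alpha' *: g)]].

Definition edge_walk (P : set V) (k : nat) (y : nat -> V) : Prop :=
  (forall i, (i <= k)%N -> is_vertex P (y i)) /\
  (forall i, (i < k)%N -> is_edge P (segment (y i) (y i.+1))).

Definition minimal_face (P : set V) (u v : V) (F : set V) : Prop :=
  [/\ is_face P F, F u, F v
    & forall G, is_face P G -> G u -> G v -> G `<=` F -> G = F].

Definition inner_cone (F : set V) (u : V) : set V :=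
  [set g | exists2 eps : R, 0 < eps & F (u + eps *: g)].

(* For a polytope the minimal face of two vertices exists and is unique, so
   [F] ranges over exactly one set for each pair of vertices. *)
Definition symmetric_inner_cone (P : set V) : Prop :=
  forall u v F, is_vertex P u -> is_vertex P v -> minimal_face P u v F ->
    inner_cone F u = [set - g | g in inner_cone F v].

Definition is_parallelotope (d : nat) (S : set V) : Prop :=
  exists (a : V) (w : d.-tuple V), free w /\
    S = [set x | exists2 lambda : 'I_d -> R,
           forall i, 0 <= lambda i <= 1
         & x = a + \sum_(i < d) lambda i *: tnth w i].

Definition nd_parallelotope (n d : nat) (P : set V) : Prop :=
  [/\ is_polytope P, has_dim P n,
      [set F | is_facet P F] #= `I_(n + d), symmetric_inner_cone P
    & forall v, is_vertex P v ->
        exists F, [/\ is_face P F, F v & is_parallelotope d F]].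

End Polyhedra.

(* Main.v *)
Require Import Defs.
From mathcomp Require Import all_boot all_order all_algebra.
From mathcomp Require Import all_classical all_reals topology normedtype.
From mathcomp Require Import ring lra.

(* At a vertex v of a simple polytope let e_i be the edge direction leaving the
   facet i, normalised by rate i (e_i) = 1, where rate k (g) is the rate of
   change along g of the slack of the facet k.  The following are equivalent:
   (1) all circuit walks are edge walks;
   (2) P satisfies the symmetric inner cone condition;
   (3) rate k (e_i) <= 0 whenever the facet k misses v.
   (1) => (3): if rate k (e_i) > 0, then rate k (e_j) < 0 for some j, because the
   facet k is nonempty, and the positive combination of e_i and e_j that keeps
   the slack of k constant is a feasible circuit at v that is not an edge.
   (3) => (1): a feasible g is the sum of the rate i (g) e_i, and there is no
   cancellation in any slack, so the support of g contains that of some e_i.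
   (3) => (2): if g is feasible at u in the minimal face of u and v, then rate k
   (g) <= 0 for all facets k through v that miss u, hence -g is feasible at v.
   (2) => (3): comparing the inner cones at the neighbours of v along e_i and e_j
   shows that the facet reached along e_i is parallel to e_j unless e_j reaches
   it too; moreover every facet that misses v is reached along some edge at v.
   Under (3), pivoting shows that each e_i decreases the slack of exactly one
   facet, so P is affinely a product of simplices, and one edge for each facet
   that misses v spans the required parallelotope. *)

Set Implicit Arguments.
Unset Strict Implicit.
Unset Printing Implicit Defensive.

Import Order.TTheory GRing.Theory Num.Theory.
Local Open Scope classical_set_scope.
Local Open Scope card_scope.
Local Open Scope ring_scope.


(** * Slacks, tight rows and faces *)

Section Slack.
Variables (R : realType) (N q : nat) (C : 'M[R]_(q, N)) (h : 'cV[R]_q).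
Implicit Types (i : 'I_q) (x g : 'cV[R]_N) (a : R).

Definition slack i x : R := (h - C *m x) i 0.
Definition rate i g : R := (- (C *m g)) i 0.
Definition tight x : {set 'I_q} := [set i | slack i x == 0]%SET.

Lemma tightP i x : reflect (slack i x = 0) (i \in tight x).
Proof. by rewrite inE; apply: eqP. Qed.

Lemma slack_def i x : slack i x = h i 0 - (C *m x) i 0.
Proof. by rewrite /slack mxE [X in _ + X]mxE. Qed.

Lemma slackE i x : (C *m x) i 0 = h i 0 - slack i x.
Proof. by rewrite !slack_def opprB addrCA subrr addr0. Qed.

Lemma rateE i g : rate i g = - (C *m g) i 0.
Proof. by rewrite /rate mxE. Qed.

Lemma rateD i g1 g2 : rate i (g1 + g2) = rate i g1 + rate i g2.
Proof. by rewrite !rateE mulmxDr mxE opprD. Qed.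

Lemma rateZ i a g : rate i (a *: g) = a * rate i g.
Proof. by rewrite !rateE -scalemxAr mxE mulrN. Qed.

Lemma rateN i g : rate i (- g) = - rate i g.
Proof. by rewrite -scaleN1r rateZ mulN1r. Qed.

Lemma rateB i g1 g2 : rate i (g1 - g2) = rate i g1 - rate i g2.
Proof. by rewrite rateD rateN. Qed.

Lemma rate0 i : rate i 0 = 0.
Proof. by rewrite !rateE mulmx0 mxE oppr0. Qed.

Lemma rate_sum (I : finType) (r : pred I) i (F : I -> 'cV[R]_N) :
  rate i (\sum_(j | r j) F j) = \sum_(j | r j) rate i (F j).
Proof. by apply: (big_morph (rate i) (rateD i) (rate0 i)). Qed.

Lemma slackD i x g : slack i (x + g) = slack i x + rate i g.
Proof. by rewrite !rateE !slack_def mulmxDr mxE opprD addrA. Qed.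

Lemma slackDZ i x a g : slack i (x + a *: g) = slack i x + a * rate i g.
Proof. by rewrite slackD rateZ. Qed.

Lemma slackB i x y : slack i x = slack i y + rate i (x - y).
Proof. by rewrite -slackD addrC subrK. Qed.

Lemma slack_midpoint i x y :
  slack i (2^-1 *: (x + y)) = (slack i x + slack i y) / 2.
Proof.
rewrite !slack_def -scalemxAr mulmxDr.
by move: (C *m x) (C *m y) => z w; rewrite !mxE; field.
Qed.

Lemma supp_rate i g : (i \in supp (C *m g)) = (rate i g != 0).
Proof. by rewrite inE rateE oppr_eq0. Qed.

End Slack.

(** Circuits without the normalisation to coprime integers, so that the geometry can be done over
    the reals. *)
Definition min_supp (R : realType) (N q : nat) (C : 'M[R]_(q, N))
    (L : {vspace 'cV[R]_N}) (g : 'cV[R]_N) : Prop :=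
  [/\ g \in L, g != 0 & forall x, x \in L -> x != 0 ->
     ~~ (supp (C *m x) \proper supp (C *m g))].

(* [L] is the direction space of the affine hull of [P] and [p] is a point of
   the relative interior of [P]. *)
Record frame (R : realType) (N q : nat) (P : set 'cV[R]_N)
    (L : {vspace 'cV[R]_N}) (p : 'cV[R]_N) (C : 'M[R]_(q, N)) (h : 'cV[R]_q) :
    Prop := Frame {
  frameE : forall x,
    P x <-> x - p \in L /\ forall i, 0 <= slack C h i x;
  frame_interior : forall i, 0 < slack C h i p;
  frame_bounded : forall g, g \in L -> (forall i, 0 <= rate C i g) -> g = 0 }.

Section Frame.
Variables (R : realType) (N q : nat) (P : set 'cV[R]_N).
Variables (L : {vspace 'cV[R]_N}) (p : 'cV[R]_N).
Variables (C : 'M[R]_(q, N)) (h : 'cV[R]_q).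
Hypothesis PF : frame P L p C h.
Implicit Types (i k : 'I_q) (x y u v g : 'cV[R]_N) (a : R) (T : {set 'I_q}).

Local Notation slack := (slack C h).
Local Notation rate := (rate C).
Local Notation tight := (tight C h).

Lemma slack_ge0 i x : P x -> 0 <= slack i x.
Proof. by move=> /(frameE PF)[_]. Qed.

Lemma slack_gt0 i x : P x -> i \notin tight x -> 0 < slack i x.
Proof. by move=> /(slack_ge0 i); rewrite inE lt_def => -> ->. Qed.

Lemma interior_mem : P p.
Proof.
apply/(frameE PF); rewrite subrr mem0v; split=> // i.
exact/ltW/(frame_interior PF).
Qed.

Lemma sub_direction x y : P x -> P y -> x - y \in L.
Proof.
move=> /(frameE PF)[xp _] /(frameE PF)[yp _].
by rewrite -(subrKA p) -(opprB y p) rpredB.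
Qed.

Lemma translate_mem x g : P x -> g \in L -> (forall i, 0 <= slack i (x + g)) ->
  P (x + g).
Proof.
move=> /(frameE PF)[xp _] gL s_ge0; apply/(frameE PF); split=> //.
by rewrite addrAC rpredD.
Qed.

(** Ratio test: boundedness gives a row with decreasing slack, and the step is the least ratio
    [slack k x / - rate k g] over such rows. *)
Lemma max_step x g : P x -> g \in L -> g != 0 ->
  (forall i, i \in tight x -> 0 <= rate i g) ->
  exists a k, [/\ 0 < a, P (x + a *: g), rate k g < 0
                & slack k (x + a *: g) = 0].
Proof.
move=> Px gL g0 g_in.
have [k0 k0_lt] : exists k, rate k g < 0.
  apply/not_existsP => nlt; case/eqP: g0; apply: (frame_bounded PF) => // i.
  by rewrite leNgt; apply/negP/nlt.
case: (@arg_minP _ _ _ k0 (fun k => rate k g < 0)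
  (fun k => slack k x / - rate k g) k0_lt) => k k_lt k_min.
have k_nt : k \notin tight x.
  by apply/negP => /g_in; rewrite leNgt k_lt.
exists (slack k x / - rate k g), k; split=> //.
- by rewrite divr_gt0 ?oppr_gt0 ?slack_gt0.
- apply: translate_mem => // [|i]; first by rewrite rpredZ.
  rewrite slackDZ; have [i_lt|i_ge] := ltP (rate i g) 0.
    have := k_min i i_lt; rewrite ler_pdivlMr ?oppr_gt0 //; lra.
  by rewrite addr_ge0 ?slack_ge0 // mulr_ge0 // divr_ge0 ?slack_ge0 // oppr_ge0 ltW.
- rewrite slackDZ; field; exact: ltr0_neq0.
Qed.

Lemma max_step_maximal x g a k : rate k g < 0 -> slack k (x + a *: g) = 0 ->
  forall b, a < b -> ~ P (x + b *: g).
Proof.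
move=> k_lt k0 b ab /(slack_ge0 k); apply/negP; rewrite -ltNge.
move: k0; rewrite !slackDZ; nra.
Qed.

Lemma small_step x g : P x -> g \in L ->
  (forall i, i \in tight x -> 0 <= rate i g) ->
  exists2 a, 0 < a & P (x + a *: g).
Proof.
move=> Px gL g_in; have [->|g0] := eqVneq g 0.
  by exists 1; rewrite ?ltr01 // scaler0 addr0.
by have [a [k [a0 Pa _ _]]] := max_step Px gL g0 g_in; exists a.
Qed.

Lemma feasible_rate x a g i : P (x + a *: g) -> 0 < a -> i \in tight x ->
  0 <= rate i g.
Proof.
move=> /(slack_ge0 i) + a0 /tightP i0.
by rewrite slackDZ i0 add0r pmulr_rge0.
Qed.

Lemma feasible_direction x a g : P x -> P (x + a *: g) -> 0 < a -> g \in L.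
Proof.
move=> Px Pa a0; have := sub_direction Pa Px.
by rewrite addrAC subrr add0r rpredZeq gt_eqF.
Qed.


Lemma midpoint_mem x y : P x -> P y -> P (2^-1 *: (x + y)).
Proof.
move=> Px Py; have -> : 2^-1 *: (x + y) = x + 2^-1 *: (y - x).
  by apply/colP => i; rewrite !mxE; field.
apply: translate_mem => [//||i]; first by rewrite rpredZ // sub_direction.
rewrite slackDZ rateB; have := slackB C h i y x; rewrite rateB.
by have := slack_ge0 i Px; have := slack_ge0 i Py; lra.
Qed.

(** A mean of two nonnegative slacks vanishes only if both do. Hence the midpoint lies in the
    relative interior of the smallest face containing [x] and [y]. *)
Lemma tight_midpoint x y : P x -> P y ->
  tight (2^-1 *: (x + y)) = (tight x :&: tight y)%SET.
Proof.
move=> Px Py; apply/setP => i; rewrite !inE slack_midpoint.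
have := slack_ge0 i Px; have := slack_ge0 i Py => y0 x0.
apply/eqP/andP => [xy0|[/eqP-> /eqP->]]; last by rewrite addr0 mul0r.
by split; apply/eqP; lra.
Qed.

(** The algebraic form of a vertex: on [L] the tight rows have trivial common kernel. *)
Definition corner v : Prop := P v /\
  forall g, g \in L -> (forall i, i \in tight v -> rate i g = 0) -> g = 0.

Definition tight_face T : set 'cV[R]_N :=
  [set x | P x /\ forall i, i \in T -> slack i x = 0].

(** The sum of the rows in [T] is a supporting functional, because nonnegative slacks with zero sum
    all vanish. *)
Lemma tight_face_face T : is_face P (tight_face T).
Proof.
exists (\sum_(i in T) row i C), (\sum_(i in T) h i 0).
have E x : ((\sum_(i in T) row i C) *m x) 0 0 =
    \sum_(i in T) h i 0 - \sum_(i in T) slack i x.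
  rewrite mulmx_suml summxE -sumrB; apply: eq_bigr => i _.
  by rewrite -row_mul mxE (slackE C h).
split=> [x Px|].
  by rewrite E lerBlDr lerDl sumr_ge0 // => i _; exact: slack_ge0.
apply/seteqP; split=> x [Px xT]; split=> //.
  by rewrite E [X in _ - X]big1 ?subr0.
move=> i iT; move: xT; rewrite E => /eqP; rewrite -subr_eq0 addrAC subrr sub0r.
rewrite oppr_eq0 psumr_eq0 => [/allP/(_ i)|j _]; last exact: slack_ge0.
by rewrite mem_index_enum iT => /(_ isT)/eqP.
Qed.

Lemma vertexP v : is_vertex P v <-> corner v.
Proof.
split=> [[c [z [cz vE]]]|[Pv vL]].
  have /= [Pv cv] : [set x | P x /\ (c *m x) 0 0 = z] v by rewrite -vE.
  (* Applied to [g] and [- g], this makes the functional constant along [g], so a small step along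
     [g] stays in the face [[set v]]. *)
  have c_le0 g : g \in L -> (forall i, i \in tight v -> rate i g = 0) ->
      (c *m g) 0 0 <= 0.
    move=> gL g0; have [i /g0->//|a a0 /cz] := small_step Pv gL.
    rewrite mulmxDr mxE cv -scalemxAr mxE gerDl.
    by rewrite pmulr_rle0.
  split=> // g gL g0; have [i /g0->//|a a0 Pa] := small_step Pv gL.
  have cg : (c *m g) 0 0 = 0.
    apply/eqP; rewrite eq_le c_le0 //= -oppr_le0.
    have := c_le0 (- g); rewrite mulmxN mxE; apply; first by rewrite rpredN.
    by move=> i /g0; rewrite rateN => ->; rewrite oppr0.
  have : [set v] (v + a *: g).
    by rewrite vE; split=> //; rewrite mulmxDr mxE cv -scalemxAr mxE cg mulr0 addr0.
  move=> /= /eqP; rewrite -subr_eq0 addrAC subrr add0r scaler_eq0 gt_eqF //=.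
  by move/eqP.
rewrite /is_vertex; suff -> : [set v] = tight_face (tight v).
  exact: tight_face_face.
apply/seteqP; split=> x /=; first by move=> ->; split=> // i /tightP.
move=> [Px xT]; apply/eqP; rewrite -subr_eq0; apply/eqP/vL.
  exact: sub_direction.
move=> i iT; have := slackB C h i x v.
by rewrite xT // (tightP _ _ _ _ iT) add0r => <-.
Qed.

Lemma vertex_mem v : is_vertex P v -> P v.
Proof. by move=> /vertexP[]. Qed.

(** From the midpoint [m] of [u] and [v] a small step away from [x] stays in [P]. The functional of
    [G] is maximal at [m], so it cannot be smaller at [x]. *)
Lemma tight_face_sub_face G u v : is_face P G -> G u -> G v ->
  tight_face (tight u :&: tight v) `<=` G.
Proof.
move=> [c [z [cz ->]]] /= [Pu cu] [Pv cv] x [Px xT]; split=> //.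
have Pm := midpoint_mem Pu Pv; set m := 2^-1 *: (u + v) in Pm.
have cm : (c *m m) 0 0 = z.
  by rewrite -scalemxAr mulmxDr mxE [X in _ * X]mxE cu cv; field.
have mx_in i : i \in tight m -> 0 <= rate i (m - x).
  rewrite tight_midpoint // => iT; have := slackB C h i m x.
  rewrite xT // add0r => <-; exact: slack_ge0.
have [a a0 /cz] := small_step Pm (sub_direction Pm Px) mx_in.
rewrite mulmxDr mxE cm -scalemxAr mxE gerDl pmulr_rle0 //.
rewrite mulmxBr mxE cm [X in _ + X]mxE.
by rewrite subr_le0 => zx; apply/eqP; rewrite eq_le zx cz.
Qed.

Lemma minimal_face_tight u v F : P u -> P v ->
  minimal_face P u v F <-> F = tight_face (tight u :&: tight v).
Proof.
move=> Pu Pv; have T_u : tight_face (tight u :&: tight v) u.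
  by split=> // i /setIP[/tightP].
have T_v : tight_face (tight u :&: tight v) v.
  by split=> // i /setIP[_ /tightP].
split=> [[Ff Fu Fv Fmin]|->].
  by rewrite [RHS]Fmin //; [exact: tight_face_face|exact: tight_face_sub_face].
split=> //; first exact: tight_face_face.
move=> G Gf Gu Gv GT; apply/seteqP; split=> //; exact: tight_face_sub_face.
Qed.

Lemma inner_coneP T u g : P u -> T \subset tight u ->
  inner_cone (tight_face T) u g <->
  [/\ g \in L, forall i, i \in tight u -> 0 <= rate i g
    & forall i, i \in T -> rate i g = 0].
Proof.
move=> Pu /fintype.subsetP Tu; split=> [[a a0 [Pa aT]]|[gL gu gT]].
  split=> [|i|i iT]; first exact: feasible_direction Pa a0.
    exact: feasible_rate Pa a0.
  move: (aT i iT); rewrite slackDZ (tightP _ _ _ _ (Tu i iT)) add0r => /eqP.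
  by rewrite mulf_eq0 gt_eqF //= => /eqP.
have [a a0 Pa] := small_step Pu gL gu; exists a => //; split=> // i iT.
by rewrite slackDZ gT // mulr0 addr0; apply/tightP/Tu.
Qed.

Lemma supp_rate_sub x g :
  (supp (C *m x) \subset supp (C *m g)) =
  [forall i, (rate i g == 0) ==> (rate i x == 0)].
Proof.
apply/fintype.subsetP/forallP => [s i|s i].
  by have := s i; rewrite !supp_rate; do 2!case: eqVneq => //= _; move=> /(_ isT).
by have := s i; rewrite !supp_rate; do 2!case: eqVneq.
Qed.

(** A support of least cardinality is taken among the nonzero vectors of [L] that vanish on [T]; a
    vector with smaller support would vanish on [T] as well. *)
Lemma min_supp_exists T g : g \in L -> g != 0 ->
  (forall i, i \in T -> rate i g = 0) ->
  exists2 g', min_supp C L g' & forall i, i \in T -> rate i g' = 0.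
Proof.
move=> gL g0 gT; pose Q s := `[< exists x, [/\ x \in L, x != 0,
  forall i, i \in T -> rate i x = 0 & #|supp (C *m x)| = s] >].
have exQ : exists s, Q s by exists #|supp (C *m g)|; apply/asboolP; exists g.
case: (ex_minnP exQ) => s /asboolP[x [xL x0 xT xs]] smin.
exists x => //; split=> // y yL y0; apply/negP => yx.
have /smin : Q #|supp (C *m y)|.
  apply/asboolP; exists y; split=> // i /xT/eqP xi.
  move: yx; rewrite properE supp_rate_sub => /andP[/forallP/(_ i)].
  by rewrite xi => /eqP.
by rewrite leqNgt -xs proper_card.
Qed.

(** Each step follows a direction that keeps all tight rows tight and stops at a new one, so the
    number of nontight rows drops. The predicate [D] allows both vectors of minimal support and
    normalised circuits as steps. *)
Lemma corner_walk (D : 'cV[R]_N -> Prop) x :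
  (forall g, min_supp C L g -> exists2 c : R, 0 < c & D (c *: g)) -> P x ->
  exists (k : nat) (y : nat -> 'cV[R]_N),
    [/\ y 0%N = x, corner (y k), forall j : nat, (j <= k)%N -> P (y j)
      & forall j : nat, (j < k)%N -> exists g a,
          [/\ D g, 0 < a, y j.+1 = y j + a *: g
            & forall b, a < b -> ~ P (y j + b *: g)]].
Proof.
move=> Dmin; have [s] := ubnP #|~: tight x|; elim: s x => // s IHs x xs Px.
have [xL|] := pselect (forall g, g \in L ->
    (forall i, i \in tight x -> rate i g = 0) -> g = 0).
  by exists 0%N, (fun=> x); split.
move=> /existsNP[g /not_implyP[gL /not_implyP[gT /eqP g0]]].
have [g1 g1min g1T] := min_supp_exists gL g0 gT.
have [g1L g1_0 _] := g1min.
have [c c0 Dc] := Dmin g1 g1min.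
have cT i : i \in tight x -> rate i (c *: g1) = 0.
  by move=> /g1T; rewrite rateZ => ->; rewrite mulr0.
have [||i /cT->//|a [k [a0 Pa k_lt k0]]] := @max_step x (c *: g1) Px.
- by rewrite rpredZ.
- by rewrite scaler_eq0 gt_eqF.
have [|l [y [y0 yl yP ystep]]] := IHs (x + a *: (c *: g1)) _ Pa.
  rewrite -ltnS; apply: leq_trans xs; rewrite ltnS.
  apply/proper_card; rewrite finset.properC; apply/fintype.properP; split.
    apply/fintype.subsetP => i iT; apply/tightP.
    by rewrite slackDZ cT // mulr0 addr0; apply/tightP.
  by exists k; [apply/tightP|apply/negP => /cT kT; rewrite kT ltxx in k_lt].
exists l.+1, (fun i : nat => if i is j.+1 then y j else x); split=> //.
  by case.
case=> [_|j]; last exact: ystep.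
exists (c *: g1), a; split=> //; exact: max_step_maximal k_lt k0.
Qed.

Lemma corner_exists : exists v, corner v.
Proof.
have [|k [y [_ yk _ _]]] := @corner_walk (min_supp C L) p _ interior_mem.
  by move=> g gmin; exists 1; rewrite ?ltr01 // scale1r.
by exists (y k).
Qed.

End Frame.


(** * Edges and pivots at the vertices of a simple polytope *)

(** The dual basis of the tight rows: [e i] leaves the facet [i] and stays in the other facets
    through [v]. Values of [e] at nontight rows are arbitrary. *)
Definition edge_dirs (R : realType) (N q : nat) (L : {vspace 'cV[R]_N})
    (C : 'M[R]_(q, N)) (h : 'cV[R]_q) (v : 'cV[R]_N) (e : 'I_q -> 'cV[R]_N) :
    Prop :=
  forall i, i \in tight C h v ->
    e i \in L /\ forall j, j \in tight C h v -> rate C j (e i) = (i == j)%:R.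

(* A frame of a simple polytope of dimension [n] in which distinct rows define
   distinct facets. *)
Record simple_frame (R : realType) (N q n : nat) (P : set 'cV[R]_N)
    (L : {vspace 'cV[R]_N}) (p : 'cV[R]_N) (C : 'M[R]_(q, N)) (h : 'cV[R]_q) :
    Prop := SimpleFrame {
  simple_is_frame : frame P L p C h;
  simple_card : forall v, corner P L C h v -> #|tight C h v| = n;
  simple_dirs : forall v, corner P L C h v -> exists e, edge_dirs L C h v e;
  simple_facet : forall i, exists2 x, P x & slack C h i x = 0 }.

Section Simple.
Variables (R : realType) (N q n : nat) (P : set 'cV[R]_N).
Variables (L : {vspace 'cV[R]_N}) (p : 'cV[R]_N).
Variables (C : 'M[R]_(q, N)) (h : 'cV[R]_q).
Hypothesis SF : simple_frame n P L p C h.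
Implicit Types (i j k l : 'I_q) (x y u v g : 'cV[R]_N) (a : R).
Implicit Types (e : 'I_q -> 'cV[R]_N).

Local Notation slack := (slack C h).
Local Notation rate := (rate C).
Local Notation tight := (tight C h).
Local Notation corner := (corner P L C h).
Local Notation edge_dirs := (edge_dirs L C h).
Local Notation PF := (simple_is_frame SF).

Lemma edge_dir_rate v e i j : edge_dirs v e -> i \in tight v -> j \in tight v ->
  rate j (e i) = (i == j)%:R.
Proof. by move=> ve iv jv; have [_ ->] := ve i iv. Qed.

Lemma edge_dir_mem v e i : edge_dirs v e -> i \in tight v -> e i \in L.
Proof. by move=> ve /ve[]. Qed.

Lemma edge_dir_neq0 v e i : edge_dirs v e -> i \in tight v -> e i != 0.
Proof.
move=> ve iv; apply/eqP => e0; have := edge_dir_rate ve iv iv.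
by rewrite e0 rate0 eqxx => /eqP; rewrite eq_sym oner_eq0.
Qed.

Lemma dirs_expand v e g : corner v -> edge_dirs v e -> g \in L ->
  g = \sum_(i in tight v) rate i g *: e i.
Proof.
move=> [Pv vL] ve gL; apply/eqP; rewrite -subr_eq0; apply/eqP/vL.
  by rewrite rpredB // rpred_sum // => i iv; rewrite rpredZ // (edge_dir_mem ve).
move=> j jv; rewrite rateB rate_sum (bigD1 j) //= big1 => [|i /andP[iv ij]].
  by rewrite rateZ (edge_dir_rate ve) // eqxx mulr1 addr0 subrr.
by rewrite rateZ (edge_dir_rate ve) // (negPf ij) mulr0.
Qed.

Lemma rate_expand v e g k : corner v -> edge_dirs v e -> g \in L ->
  rate k g = \sum_(i in tight v) rate i g * rate k (e i).
Proof.
move=> cv ve gL; rewrite {1}(dirs_expand cv ve gL) rate_sum.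
by apply: eq_bigr => i _; rewrite rateZ.
Qed.

Lemma slack_nontight v k : corner v -> k \notin tight v -> 0 < slack k v.
Proof. by move=> [Pv _] kv; exact: (slack_gt0 PF). Qed.

(* The facet of [k] is nonempty, so moving away from a corner off that facet
   must be able to decrease the slack of [k]. *)
Lemma nontight_decreases v e k : corner v -> edge_dirs v e -> k \notin tight v ->
  exists2 i, i \in tight v & rate k (e i) < 0.
Proof.
move=> cv ve kv; have [x Px kx] := simple_facet SF k; have [Pv _] := cv.
apply/not_exists2P => rge; have := slack_nontight cv kv.
have := slackB C h k x v; rewrite kx (rate_expand _ cv ve) => [|]; last first.
  exact: (sub_direction PF).
suff : 0 <= \sum_(i in tight v) rate i (x - v) * rate k (e i) by lra.
apply: sumr_ge0 => i iv; apply: mulr_ge0.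
  have := slackB C h i x v; rewrite (tightP _ _ _ _ iv) add0r => <-.
  exact: (slack_ge0 PF).
by rewrite leNgt; apply/negP => ki; case: (rge i) => /(_ _).
Qed.

(** A simplex pivot from [v] to [u], in which [i] leaves and [k] enters the set of tight rows. *)
Definition pivot v g i u k : Prop :=
  [/\ k \notin tight v, rate k g < 0, corner u,
      tight u = (k |: (tight v :\ i))%SET
    & exists2 a, 0 < a & u = v + a *: g].

Lemma pivot_of_step v e i k a : corner v -> edge_dirs v e -> i \in tight v ->
  0 < a -> P (v + a *: e i) -> rate k (e i) < 0 -> slack k (v + a *: e i) = 0 ->
  pivot v (e i) i (v + a *: e i) k.
Proof.
move=> cv ve iv a0 Pa k_lt k0.
have kv : k \notin tight v.
  apply/negP => kv; move: k_lt; rewrite (edge_dir_rate ve) //.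
  by rewrite ltNge ler0n.
set u := v + a *: e i in Pa k0 *.
have sub_u : (k |: (tight v :\ i))%SET \subset tight u.
  apply/fintype.subsetP => j /setU1P[->|/setD1P[ji jv]]; first exact/tightP.
  apply/tightP; rewrite slackDZ (tightP _ _ _ _ jv) (edge_dir_rate ve) //.
  by rewrite eq_sym (negPf ji) mulr0 addr0.
have cu : corner u.
  split=> // g gL gu; have gE := dirs_expand cv ve gL.
  rewrite (bigD1 i) //= big1 ?addr0 in gE; last first.
    move=> j /andP[jv ji]; rewrite gu ?scale0r //.
    by apply: (fintype.subsetP sub_u); rewrite in_setU1 in_setD1 ji jv orbT.
  have := gu k; rewrite gE rateZ (fintype.subsetP sub_u) ?setU11 // => /(_ isT).
  by move/eqP; rewrite mulf_eq0 (lt_eqF k_lt) orbF => /eqP ->; rewrite scale0r.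
split=> //; last by exists a.
(* Simplicity turns the inclusion into an equality: both sets have [n] elements. *)
apply/esym/eqP; rewrite eqEcard sub_u (simple_card SF) // cardsU1 in_setD1.
rewrite (negPf kv) andbF /= -(simple_card SF cv).
by rewrite [in X in (X <= _)%N](cardsD1 i) iv.
Qed.

Lemma pivot_exists v e i : corner v -> edge_dirs v e -> i \in tight v ->
  exists u k, pivot v (e i) i u k.
Proof.
move=> cv ve iv; have [Pv _] := cv.
have [|a [k [a0 Pa k_lt k0]]] := max_step PF Pv (edge_dir_mem ve iv)
    (edge_dir_neq0 ve iv).
  by move=> j jv; rewrite (edge_dir_rate ve) // ler0n.
by exists (v + a *: e i), k; exact: pivot_of_step.
Qed.

(** Feasibility of each endpoint bounds the length of the other step, so the endpoints coincide;
    their only tight row missing at [v] is the entering one. *)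
Lemma pivot_inj v g i u u' k l :
  P v -> pivot v g i u k -> pivot v g i u' l -> k = l.
Proof.
move=> Pv [kv k_lt [Pu _] uE [a _ ua]] [lv l_lt [Pu' _] u'E [b _ u'b]].
have ku : slack k u = 0 by apply/tightP; rewrite uE setU11.
have lu' : slack l u' = 0 by apply/tightP; rewrite u'E setU11.
have := slack_ge0 PF k Pu'; have := slack_ge0 PF l Pu.
move: ku lu'; rewrite ua u'b !slackDZ => ku lu' lu ku'.
have ab : a = b by apply/eqP; rewrite eq_le; apply/andP; split; nra.
have : k \in tight u by rewrite uE setU11.
by rewrite ua ab -u'b u'E => /setU1P[//|/setD1P[_]]; rewrite (negPf kv).
Qed.

(** The edge leaving [k] at [u] is the old edge reversed, rescaled by a negative factor to have rate
    one on [k]. *)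
Lemma pivot_back_dir v e i u k e' : corner v -> edge_dirs v e ->
  i \in tight v -> pivot v (e i) i u k -> edge_dirs u e' ->
  e' k = (rate k (e i))^-1 *: e i.
Proof.
move=> cv ve iv [kv k_lt cu uE _] ue'.
have ku : k \in tight u by rewrite uE setU11.
have k_neq0 := ltr0_neq0 k_lt.
apply/eqP; rewrite -subr_eq0; apply/eqP/cu.2.
  by rewrite rpredB ?rpredZ ?(edge_dir_mem ue') ?(edge_dir_mem ve).
move=> t tu; rewrite rateB rateZ (edge_dir_rate ue') //.
move: tu; rewrite uE => /setU1P[->|/setD1P[ti tv]].
  by rewrite eqxx mulVf // subrr.
have -> : (k == t) = false by apply: contraNF kv => /eqP ->.
by rewrite (edge_dir_rate ve iv tv) eq_sym (negPf ti) mulr0 subrr.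
Qed.

(** * Feasible circuits and the signs of the rates *)

Definition nonpos_rates : Prop := forall v e, corner v -> edge_dirs v e ->
  forall i k, i \in tight v -> k \notin tight v -> rate k (e i) <= 0.

(** The local form of the walk condition: a feasible circuit leaves at most one tight facet, so it
    points along an edge. *)
Definition feasible_along_edges : Prop :=
  forall v g, corner v -> min_supp C L g ->
    (forall i, i \in tight v -> 0 <= rate i g) ->
    forall i j, i \in tight v -> j \in tight v ->
      0 < rate i g -> 0 < rate j g -> i = j.

Lemma along_edges_nonpos : feasible_along_edges -> nonpos_rates.
Proof.
move=> along v e cv ve i k iv kv; rewrite leNgt; apply/negP => ki.
have [j jv kj] := nontight_decreases cv ve kv.
have ij : i != j by apply: contraTneq ki => ->; rewrite -leNgt ltW.
pose g := - rate k (e j) *: e i + rate k (e i) *: e j.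
have gr l : l \in tight v ->
    rate l g = - rate k (e j) * (i == l)%:R + rate k (e i) * (j == l)%:R.
  by move=> lv; rewrite /g rateD !rateZ !(edge_dir_rate ve _ lv).
have gL : g \in L by rewrite rpredD ?rpredZ ?(edge_dir_mem ve).
have gi : 0 < rate i g.
  by rewrite gr // eqxx eq_sym (negPf ij) mulr0 addr0 mulr1 oppr_gt0.
have gj : 0 < rate j g.
  by rewrite gr // eqxx (negPf ij) mulr0 add0r mulr1.
suff g_min : min_supp C L g.
  suff ij' : i = j by rewrite ij' eqxx in ij.
  apply: (along v g) => // l lv; rewrite gr //.
  by rewrite addr_ge0 // mulr_ge0 ?ler0n ?oppr_ge0 // ltW.
split=> // [|x xL x0].
  by apply/eqP => g0; rewrite g0 rate0 ltxx in gi.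
(* A vector supported within [g] lies in the plane of [e i] and [e j] and has rate zero on [k]; it
   is thus a nonzero multiple of [g] and has the same support. *)
apply/negP; rewrite properE !supp_rate_sub => /andP[/forallP xg].
case/negP; apply/forallP => l; apply/implyP => xl.
have xE : x = rate i x *: e i + rate j x *: e j.
  rewrite {1}(dirs_expand cv ve xL) (bigD1 i) //= (bigD1 j) /=; last first.
    by rewrite jv eq_sym.
  rewrite big1 ?addr0 // => t /andP[/andP[tv ti] tj].
  have := xg t; rewrite gr // ![_ == t]eq_sym (negPf ti) (negPf tj).
  by rewrite !mulr0 addr0 eqxx => /eqP ->; rewrite scale0r.
have xk : rate i x * rate k (e i) + rate j x * rate k (e j) = 0.
  rewrite -!rateZ -rateD -xE; apply/eqP/(implyP (xg k)).
  by rewrite /g rateD !rateZ mulNr mulrC addNr.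
have jx : rate j x = - rate i x * rate k (e i) / rate k (e j).
  apply/eqP; rewrite eq_sym -subr_eq0; apply/eqP.
  have kj0 := ltr0_neq0 kj.
  apply: (mulfI kj0); rewrite mulr0 -[RHS]oppr0 -xk; field => //.
have xgE : x = (- rate i x / rate k (e j)) *: g.
  rewrite {1}xE /g scalerDr !scalerA jx; congr (_ *: _ + _ *: _).
  - by field; exact: ltr0_neq0.
  - by field; exact: ltr0_neq0.
have := xl; rewrite {1}xgE rateZ mulf_eq0 => /orP[|//].
move=> c0; case/eqP: x0; rewrite xgE; apply/eqP.
by rewrite scaler_eq0 c0.
Qed.

Lemma nonpos_along_edges : nonpos_rates -> feasible_along_edges.
Proof.
move=> nonpos v g cv [gL g0 g_min] g_in i j iv jv gi gj.
have [e ve] := simple_dirs SF cv.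
apply/eqP/negPn/negP => ij.
have /negP := g_min (e i) (edge_dir_mem ve iv) (edge_dir_neq0 ve iv); apply.
rewrite properE !supp_rate_sub; apply/andP; split; last first.
  apply/negP => /forallP/(_ j); rewrite (edge_dir_rate ve) // (negPf ij) eqxx /=.
  by rewrite gt_eqF.
apply/forallP => l; apply/implyP => gl.
have [lv|lv] := boolP (l \in tight v).
  rewrite (edge_dir_rate ve) //; have [il|_] := eqVneq i l; last by rewrite eqxx.
  by rewrite -il gt_eqF in gl.
(* Off [v] all terms of the expansion have the same sign, so a zero sum forces each of them to
   vanish. *)
move: gl; rewrite (rate_expand l cv ve) // -oppr_eq0 -sumrN psumr_eq0; last first.
  by move=> t tv; rewrite -mulrN mulr_ge0 ?g_in // oppr_ge0; exact: (nonpos v e).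
move=> /allP/(_ i (mem_index_enum _)); rewrite iv /= oppr_eq0 mulf_eq0.
by rewrite gt_eqF.
Qed.


(** * Symmetric inner cones and the signs of the rates *)

Lemma nonpos_symmetric : nonpos_rates -> symmetric_inner_cone P.
Proof.
move=> nonpos; suff cone_opp u v g T : corner u -> corner v ->
    T = (tight u :&: tight v)%SET ->
    inner_cone (tight_face P C h T) u g -> inner_cone (tight_face P C h T) v (- g).
  move=> u v F /(vertexP PF) cu /(vertexP PF) cv.
  move=> /(minimal_face_tight PF _ cu.1 cv.1) ->.
  apply/seteqP; split=> g /=.
    by move=> ug; exists (- g); rewrite ?opprK //; exact: cone_opp ug.
  by move=> [g' vg' <-]; apply: cone_opp vg' => //; rewrite finset.setIC.
move=> cu cv TE; have [e ue] := simple_dirs SF cu.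
have Tu : T \subset tight u by rewrite TE finset.subsetIl.
have Tv : T \subset tight v by rewrite TE finset.subsetIr.
move=> /(inner_coneP PF _ cu.1 Tu)[gL gu gT].
apply/(inner_coneP PF _ cv.1 Tv); split=> [|i iv|i iT].
- by rewrite rpredN.
- rewrite rateN oppr_ge0; have [iu|iu] := boolP (i \in tight u).
    by rewrite gT // TE inE iu.
  rewrite (rate_expand i cu ue gL) sumr_le0 // => j ju.
  by rewrite mulr_ge0_le0 ?gu // (nonpos u e).
- by rewrite rateN gT // oppr0.
Qed.

(* The two neighbours of [v] along [e i] and [e j] span a parallelogram with
   [v] when they leave through different facets [k] and [l]. *)
Lemma symmetric_pivots v e i j u u' k l : symmetric_inner_cone P ->
  corner v -> edge_dirs v e -> i \in tight v -> j \in tight v -> i != j ->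
  pivot v (e i) i u k -> pivot v (e j) j u' l -> k != l -> rate k (e j) = 0.
Proof.
move=> sym cv ve iv jv ij [kv k_lt cu uE _] [lv l_lt cu' u'E _] kl.
pose T := (tight u :&: tight u')%SET; pose F := tight_face P C h T.
have Tu : T \subset tight u by exact: finset.subsetIl.
have Tu' : T \subset tight u' by exact: finset.subsetIr.
(* Since [k] and [l] differ, neither entering row is tight at both neighbours, so their minimal face
   still contains [v]. *)
have memT t : t \in T -> [/\ t \in tight v, t != i & t != j].
  rewrite /T uE u'E => /setIP[/setU1P[->|/setD1P[ti tv]]].
    move=> /setU1P[kl'|/setD1P[_ kv']]; first by rewrite kl' eqxx in kl.
    by rewrite kv' in kv.
  by move=> /setU1P[tl|/setD1P[tj _]] //; rewrite tl (negPf lv) in tv.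
have coneE : inner_cone F u = [set - g | g in inner_cone F u'].
  apply: sym; [exact/(vertexP PF)|exact/(vertexP PF)|].
  exact/(minimal_face_tight PF _ cu.1 cu'.1).
have eL := edge_dir_mem ve.
apply/eqP; rewrite eq_le; apply/andP; split.
  (* This combination has rate zero on [k], so it lies in the cone at [u]. Its opposite lies in the
     cone at [u'], where [i] is tight, and this gives the upper bound. *)
  pose g := rate k (e j) *: e i - rate k (e i) *: e j.
  have gr t : t \in tight v ->
      rate t g = rate k (e j) * (i == t)%:R - rate k (e i) * (j == t)%:R.
    by move=> tv; rewrite /g rateB !rateZ !(edge_dir_rate ve _ tv).
  have : inner_cone F u g.
    apply/(inner_coneP PF _ cu.1 Tu); split=> [|t|t /memT[tv ti tj]].
    - by rewrite rpredB // rpredZ // eL.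
    - rewrite uE => /setU1P[->|/setD1P[ti tv]].
        by rewrite /g rateB !rateZ mulrC subrr.
      rewrite gr // eq_sym (negPf ti) mulr0 sub0r -mulNr mulr_ge0 //.
      by rewrite oppr_ge0 ltW.
    - by rewrite gr // ![_ == t]eq_sym (negPf ti) (negPf tj) !mulr0 subrr.
  rewrite coneE.
  move=> -[g' /(inner_coneP PF _ cu'.1 Tu')[_ g'_ge _] /(canRL opprK) g'E].
  have := g'_ge i; rewrite u'E in_setU1 in_setD1 ij iv orbT => /(_ isT).
  by rewrite g'E rateN gr // eqxx eq_sym (negPf ij) mulr0 subr0 mulr1 oppr_ge0.
(* The lower bound: [- e j] lies in the cone at [u'], hence [e j] lies in the cone at [u], where [k]
   is tight. *)
have : inner_cone F u (e j).
  rewrite coneE; exists (- e j); rewrite ?opprK //.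
  apply/(inner_coneP PF _ cu'.1 Tu'); split=> [|t|t /memT[tv ti tj]].
  - by rewrite rpredN eL.
  - rewrite u'E => /setU1P[->|/setD1P[tj tv]]; first by rewrite rateN oppr_ge0 ltW.
    by rewrite rateN (edge_dir_rate ve) // eq_sym (negPf tj) oppr0.
  - by rewrite rateN (edge_dir_rate ve) // eq_sym (negPf tj) oppr0.
move=> /(inner_coneP PF _ cu.1 Tu)[_ + _]; apply.
by rewrite uE setU11.
Qed.

(* Induction on the number of corners with a smaller slack of [k]: if no edge
   at [v] leaves through the facet of [k], follow an edge that decreases the
   slack of [k]; no edge at its other end leaves through [k] either. *)
Lemma symmetric_pivot_onto v e k : symmetric_inner_cone P ->
  corner v -> edge_dirs v e -> k \notin tight v ->
  exists i u, i \in tight v /\ pivot v (e i) i u k.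
Proof.
move=> sym.
(* Corners are recorded by their tight sets, which form a finite type. *)
pose below v : {set {set 'I_q}} :=
  [set T | `[< exists w, [/\ corner w, tight w = T & slack k w < slack k v] >]]%SET.
have [s] := ubnP #|below v|; elim: s v e => // s IHs v e vs cv ve kv.
have [[i [u iuk]]|nex] :=
  pselect (exists i u, i \in tight v /\ pivot v (e i) i u k).
  by exists i, u.
have [i iv ki] := nontight_decreases cv ve kv.
have [u [l vul]] := pivot_exists cv ve iv.
have [lv l_lt cu uE [a a0 uEa]] := vul.
have kl : k != l by apply: contra_notN nex => /eqP ->; exists i, u.
have kule : k \notin tight u.
  by rewrite uE in_setU1 (negPf kl) in_setD1 (negPf kv) andbF.
have [e' ue'] := simple_dirs SF cu.
have lu : l \in tight u by rewrite uE setU11.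
have e'lE := pivot_back_dir cv ve iv vul ue'.
(* The same edge, traversed from [u] to [v], enters through [i]. *)
have back : pivot u (e' l) l v i.
  have vE : v = u + (- a * rate l (e i)) *: e' l.
    rewrite e'lE scalerA -mulrA mulfV ?mulr1 ?ltr0_neq0 //.
    by rewrite uEa scaleNr addrK.
  rewrite vE; apply: pivot_of_step => //; rewrite -?vE.
  - by rewrite mulNr -mulrN mulr_gt0 // oppr_gt0.
  - exact: cv.1.
  - by rewrite e'lE rateZ (edge_dir_rate ve iv iv) eqxx mulr1 invr_lt0.
  - exact/tightP.
have ksl : slack k u < slack k v.
  by rewrite uEa slackDZ gtrDl pmulr_rlt0.
have [t [w [tu utk]]] : exists t w, t \in tight u /\ pivot u (e' t) t w k.
  apply: (IHs u e') => //; rewrite -ltnS; apply: leq_trans vs; rewrite ltnS.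
  apply/proper_card/fintype.properP; split.
    apply/fintype.subsetP => T; rewrite !finset.in_set => /asboolP[w [cw wT ws]].
    by apply/asboolP; exists w; split=> //; exact: lt_trans ws ksl.
  exists (tight u); first by rewrite finset.in_set; apply/asboolP; exists u.
  rewrite finset.in_set; apply/asboolP => -[w [cw wu]].
  suff -> : w = u by rewrite ltxx.
  apply/eqP; rewrite -subr_eq0; apply/eqP/cu.2.
    by apply: (sub_direction PF); [exact: cw.1|exact: cu.1].
  move=> j ju; have := slackB C h j w u; rewrite (tightP _ _ _ _ ju) add0r => <-.
  by apply/tightP; rewrite wu.
have ki0 : k != i by apply: contraNneq kv => ->.
(* Were [t] equal to [l], the pivot would be [back], which enters [i] and not [k]. For two distinct
   edges at [u], [symmetric_pivots] makes [rate k (e' l)] zero, although [e' l] is a nonzero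
   multiple of [e i], which decreases the slack of [k]. *)
have tl : t != l.
  apply/eqP => tl; rewrite tl in utk.
  by rewrite (pivot_inj cu.1 utk back) eqxx in ki0.
have := symmetric_pivots sym cu ue' tu lu tl utk back ki0.
move/eqP; rewrite e'lE rateZ mulf_eq0 invr_eq0 !lt_eqF //.
Qed.

(** Some edge at [v] reaches the facet [k]. Either [e j] reaches it too and has negative rate, or
    the parallelogram argument gives rate zero. *)
Lemma symmetric_nonpos : symmetric_inner_cone P -> nonpos_rates.
Proof.
move=> sym v e cv ve j k jv kv.
have [i [u [iv vuk]]] := symmetric_pivot_onto sym cv ve kv.
have [u' [l vu'l]] := pivot_exists cv ve jv.
have [<-|ij] := eqVneq i j; first by case: vuk => _ /ltW.
have [->|kl] := eqVneq k l; first by case: vu'l => _ /ltW.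
by rewrite (symmetric_pivots sym cv ve iv jv ij vuk vu'l kl).
Qed.

(** Let [m] enter in the pivot along [e i]. If [e i] also decreased the slack of another nontight
    row, the reversed direction at the new corner would increase it, against the sign condition
    there. *)
Lemma nonpos_single_facet v e i k l : nonpos_rates -> corner v ->
  edge_dirs v e -> i \in tight v -> k \notin tight v -> l \notin tight v ->
  rate k (e i) != 0 -> rate l (e i) != 0 -> k = l.
Proof.
move=> nonpos cv ve iv; have [u [m vum]] := pivot_exists cv ve iv.
suff only_m t : t \notin tight v -> rate t (e i) != 0 -> t = m.
  by move=> kv lv /only_m-> // /only_m->.
move=> tv t0; have [mv m_lt cu uE _] := vum; apply/eqP/negPn/negP => tm.
have [e' ue'] := simple_dirs SF cu.
have mu : m \in tight u by rewrite uE setU11.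
have tu : t \notin tight u.
  by rewrite uE in_setU1 (negPf tm) in_setD1 (negPf tv) andbF.
have := nonpos u e' cu ue' m t mu tu.
rewrite (pivot_back_dir cv ve iv vum ue') rateZ leNgt nmulr_rgt0 ?invr_lt0 //.
by rewrite lt_neqAle t0 (nonpos v e).
Qed.

End Simple.


(** * The parallelotope through a vertex *)

Section Block.
Variables (R : realType) (N q n : nat) (P : set 'cV[R]_N).
Variables (L : {vspace 'cV[R]_N}) (p : 'cV[R]_N).
Variables (C : 'M[R]_(q, N)) (h : 'cV[R]_q).
Hypothesis SF : simple_frame n P L p C h.
Hypothesis nonpos : nonpos_rates P L C h.

Local Notation slack := (slack C h).
Local Notation rate := (rate C).
Local Notation tight := (tight C h).
Local Notation corner := (corner P L C h).
Local Notation edge_dirs := (edge_dirs L C h).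
Local Notation PF := (simple_is_frame SF).

Section AtCorner.
Variables (v : 'cV[R]_N) (e : 'I_q -> 'cV[R]_N).
Hypotheses (cv : corner v) (ve : edge_dirs v e).
Implicit Types (j : 'I_#|~: tight v|) (lam : 'I_#|~: tight v| -> R).

Lemma nontight_enum j : enum_val j \notin tight v.
Proof. by have := enum_valP j; rewrite finset.in_setC. Qed.

Lemma exit_exists j : exists i, (i \in tight v) && (rate (enum_val j) (e i) < 0).
Proof.
have [i iv ki] := nontight_decreases SF cv ve (nontight_enum j).
by exists i; rewrite iv.
Qed.

Definition exit j : 'I_q := xchoose (exit_exists j).

Lemma exit_tight j : exit j \in tight v.
Proof. by case/andP: (xchooseP (exit_exists j)). Qed.

Lemma exit_lt0 j : rate (enum_val j) (e (exit j)) < 0.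
Proof. by case/andP: (xchooseP (exit_exists j)). Qed.

Lemma exit_other j k : k \notin tight v -> k != enum_val j ->
  rate k (e (exit j)) = 0.
Proof.
move=> kv kj; apply: contra_neq_eq kj => k0.
apply: (nonpos_single_facet SF nonpos cv ve (exit_tight j)) => //.
  exact: nontight_enum.
exact: ltr0_neq0 (exit_lt0 j).
Qed.

(** The direction [e (exit j)] decreases the slack of [enum_val j] and of no other row missing
    [v]. *)
Lemma exit_inj : injective exit.
Proof.
move=> j1 j2 j12; apply: enum_val_inj.
apply/eqP; apply: contraTT (exit_lt0 j1) => j1_2.
by rewrite j12 exit_other ?ltxx // nontight_enum.
Qed.

(** The step at which the slack of [enum_val j] runs out; [exit_vector j] is then the whole edge
    from [v] to its neighbour. *)
Definition exit_length j := slack (enum_val j) v / - rate (enum_val j) (e (exit j)).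

Definition exit_vector j : 'cV[R]_N := exit_length j *: e (exit j).

Lemma exit_length_gt0 j : 0 < exit_length j.
Proof.
rewrite divr_gt0 ?oppr_gt0 ?exit_lt0 //; apply: (slack_nontight SF cv).
exact: nontight_enum.
Qed.

Lemma exit_vector_mem j : exit_vector j \in L.
Proof. by rewrite rpredZ // (edge_dir_mem ve) // exit_tight. Qed.

Lemma rate_exit_tight lam i : i \in tight v ->
  rate i (\sum_j lam j *: exit_vector j) =
  \sum_j lam j * (exit_length j * (exit j == i)%:R).
Proof.
move=> iv; rewrite rate_sum; apply: eq_bigr => j _.
by rewrite !rateZ (edge_dir_rate ve (exit_tight j) iv).
Qed.

Lemma rate_exit lam j :
  rate (exit j) (\sum_j lam j *: exit_vector j) = lam j * exit_length j.
Proof.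
rewrite rate_exit_tight ?exit_tight // (bigD1 j) //= eqxx mulr1 big1 ?addr0 //.
by move=> j' j'j; rewrite (inj_eq exit_inj) (negPf j'j) !mulr0.
Qed.

Lemma rate_exit_nontight lam j :
  rate (enum_val j) (\sum_j lam j *: exit_vector j) =
  - lam j * slack (enum_val j) v.
Proof.
rewrite rate_sum (bigD1 j) //= big1 => [|j' j'j].
  rewrite addr0 rateZ /exit_vector rateZ /exit_length; field.
  exact: ltr0_neq0 (exit_lt0 j).
rewrite /exit_vector !rateZ exit_other ?mulr0 ?nontight_enum //.
by rewrite eq_sym (inj_eq enum_val_inj).
Qed.

(** In the coordinates [lam], the slack of [exit j] is [lam j * exit_length j] and that of
    [enum_val j] is [1 - lam j] times its value at [v]. These two rows bound [lam j] by 0 and 1. *)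
Lemma exit_face_parallelotope :
  is_parallelotope #|~: tight v|
    (tight_face P C h (tight v :\: [set exit j | j in 'I_#|~: tight v|])).
Proof.
have [Pv vL] := cv.
exists v, [tuple exit_vector j | j < #|~: tight v|]; split.
  apply/freeP => lam lam0 j; have := rate_exit lam j.
  rewrite [X in rate _ X](_ : _ = 0) ?rate0 => [/esym/eqP|].
    by rewrite mulf_eq0 (gt_eqF (exit_length_gt0 j)) orbF => /eqP.
  by rewrite -[RHS]lam0; apply: eq_bigr => i _; rewrite -tnth_nth tnth_mktuple.
have sumE lam : \sum_j lam j *: tnth [tuple exit_vector j | j < #|~: tight v|] j =
    \sum_j lam j *: exit_vector j.
  by apply: eq_bigr => j _; rewrite tnth_mktuple.
apply/seteqP; split=> x.
  move=> [Px xT]; have xvL : x - v \in L by exact: (sub_direction PF).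
  have rx i : i \in tight v -> rate i (x - v) = slack i x.
    by move=> iv; rewrite (slackB C h i x v) (tightP _ _ _ _ iv) add0r.
  pose lam j := rate (exit j) (x - v) / exit_length j.
  have xvE : x - v = \sum_j lam j *: exit_vector j.
    apply/eqP; rewrite -subr_eq0; apply/eqP/vL => [|i iv].
      by rewrite rpredB // rpred_sum // => j _; rewrite rpredZ // exit_vector_mem.
    rewrite rateB; have [/imsetP[j _ ->]|ni] :=
      boolP (i \in [set exit j | j in 'I_#|~: tight v|]%SET).
      by rewrite rate_exit divfK ?subrr // gt_eqF // exit_length_gt0.
    rewrite rx // xT ?finset.in_setD ?ni // rate_exit_tight //.
    rewrite big1 ?subrr // => j _.
    have -> : (exit j == i) = false.
      by apply: contraNF ni => /eqP <-; exact: imset_f.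
    by rewrite !mulr0.
  exists lam => [j|]; last by rewrite sumE -xvE addrC subrK.
  have len0 := exit_length_gt0 j; apply/andP; split.
    by rewrite divr_ge0 ?(ltW len0) // rx ?exit_tight // (slack_ge0 PF).
  have := slack_ge0 PF (enum_val j) Px.
  rewrite (slackB C h _ x v) xvE rate_exit_nontight mulNr subr_ge0.
  by rewrite ger_pMl // (slack_nontight SF cv (nontight_enum j)).
move=> [lam lam01]; rewrite sumE => ->; set y := \sum_j _.
have yL : y \in L by rewrite rpred_sum // => j _; rewrite rpredZ // exit_vector_mem.
split.
  apply: (translate_mem PF) => // i; have [iv|iv] := boolP (i \in tight v).
    rewrite slackD (tightP _ _ _ _ iv) add0r rate_exit_tight // sumr_ge0 // => j _.
    have [lam0 _] := andP (lam01 j); have len0 := ltW (exit_length_gt0 j).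
    by rewrite mulr_ge0 // mulr_ge0 // ler0n.
  have iC : i \in (~: tight v)%SET by rewrite finset.in_setC.
  rewrite -(enum_rankK_in iC iC) slackD rate_exit_nontight mulNr subr_ge0.
  rewrite ger_pMl; first by case/andP: (lam01 (enum_rank_in iC i)).
  exact: (slack_nontight SF cv (nontight_enum _)).
move=> i /setDP[iv ni]; rewrite slackD (tightP _ _ _ _ iv) add0r rate_exit_tight //.
rewrite big1 // => j _.
have -> : (exit j == i) = false.
  by apply: contraNF ni => /eqP <-; exact: imset_f.
by rewrite !mulr0.
Qed.

Lemma card_nontight_le : (#|~: tight v| <= n)%N.
Proof.
rewrite -(simple_card SF cv) -[X in (X <= _)%N]card_ord -(card_imset _ exit_inj).
apply/subset_leq_card/fintype.subsetP => _ /imsetP[j _ ->]; exact: exit_tight.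
Qed.

Lemma card_nontight_gt0 : (0 < n)%N -> (0 < #|~: tight v|)%N.
Proof.
rewrite -{1}(simple_card SF cv) => /card_gt0P[i iv].
have [u [k [kv _ _ _ _]]] := pivot_exists SF cv ve iv.
by apply/card_gt0P; exists k; rewrite finset.in_setC.
Qed.

End AtCorner.

Lemma nonpos_parallelotope v : is_vertex P v ->
  exists F, [/\ is_face P F, F v & is_parallelotope (q - n) F].
Proof.
move=> /(vertexP PF) cv; have [e ve] := simple_dirs SF cv.
have <- : #|~: tight v| = (q - n)%N.
  by rewrite cardsCs finset.setCK card_ord (simple_card SF).
exists (tight_face P C h (tight v :\: [set exit cv ve j | j in 'I_#|~: tight v|])).
split; [exact: tight_face_face PF _| |exact: exit_face_parallelotope].
by split=> [|i /setDP[/tightP]] //; exact: cv.1.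
Qed.

(** The difference [q - n] counts the rows missing a corner: a pivot enters one of them, and [exit]
    injects them into the [n] tight rows. *)
Lemma nonpos_card : (0 < n)%N -> (n < q <= n + n)%N.
Proof.
move=> n0; have [v cv] := corner_exists PF; have [e ve] := simple_dirs SF cv.
have qE : q = (n + #|~: tight v|)%N.
  by rewrite -{1}(simple_card SF cv) cardsC card_ord.
rewrite qE leq_add2l (card_nontight_le cv ve) andbT -{1}[n]addn0 ltn_add2l.
exact: (card_nontight_gt0 cv ve).
Qed.

End Block.


(** * Dimensions of faces and facets *)

Section Dim.
Variables (R : realType) (N : nat).
Implicit Types (S P F G : set 'cV[R]_N) (D U : {vspace 'cV[R]_N}) (x y : 'cV[R]_N).

(** Trades the affine basis for the direction space, the least subspace containing all differences
    of points of [S]. *)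
Lemma has_dim_direction S k : has_dim S k -> exists D,
  [/\ \dim D = k, exists x, S x, forall x y, S x -> S y -> x - y \in D
    & forall U, (forall x y, S x -> S y -> x - y \in U) -> (D <= U)%VS].
Proof.
move=> [x0 [X [Sx0 freeX SX xX]]]; exists <<X>>%VS; split.
- by move: freeX; rewrite /free size_tuple => /eqP.
- by exists x0.
- by move=> x y /xX xD /xX yD; rewrite -(subrKA x0) -(opprB y) rpredB.
- move=> U SU; apply/span_subvP => _ /tnthP[i ->].
  by have := SU _ _ (SX i) Sx0; rewrite addrAC subrr add0r.
Qed.

Lemma has_dim_le S S' k k' : has_dim S k -> has_dim S' k' -> S `<=` S' ->
  (k <= k')%N.
Proof.
move=> /has_dim_direction[D [<- _ _ DU]] /has_dim_direction[D' [<- _ D'in _]] SS'.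
by apply/dimvS/DU => x y /SS' xS /SS' yS; exact: D'in.
Qed.

Lemma has_dim_inj S k k' : has_dim S k -> has_dim S k' -> k = k'.
Proof.
move=> Sk Sk'; apply/eqP; rewrite eqn_leq.
by rewrite (has_dim_le Sk Sk') // (has_dim_le Sk' Sk).
Qed.

Lemma mem_ker_row (c : 'rV[R]_N) x :
  (x \in lker (linfun (mulmx c))) = ((c *m x) 0 0 == 0).
Proof.
rewrite memv_ker lfunE /=; apply/eqP/eqP => [->|cx0]; first by rewrite mxE.
by rewrite [LHS]mx11_scalar cx0 raddf0.
Qed.

(** Both sets have the same direction space, so the functional that cuts out [F] is constant on
    [G]. *)
Lemma face_eq_dim P F G k : is_face P F -> F `<=` G -> G `<=` P ->
  has_dim F k -> has_dim G k -> F = G.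
Proof.
move=> [c [z [cz FE]]] FG GP /has_dim_direction[D [Dk [f0 Ff0] _ DU]].
move=> /has_dim_direction[E [Ek _ Ein _]].
have DE : D = E.
  apply/eqP; rewrite eqEdim Dk Ek leqnn andbT; apply: DU => x y /FG Gx /FG Gy.
  exact: Ein.
have cF x : F x -> (c *m x) 0 0 = z by rewrite FE => -[].
have Df : (D <= lker (linfun (mulmx c)))%VS.
  apply: DU => x y /cF cx /cF cy.
  by rewrite mem_ker_row mulmxBr mxE [X in _ + X]mxE cx cy subrr.
apply/seteqP; split=> // x Gx; rewrite FE; split; first exact: GP.
have := Ein _ _ Gx (FG _ Ff0); rewrite -DE => /(subvP Df).
by rewrite mem_ker_row mulmxBr mxE [X in _ + X]mxE subr_eq0 => /eqP->; exact: cF.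
Qed.
End Dim.

(** * The frame of a polyhedron in minimal representation *)

Lemma polyhedron_midpoint (R : realType) (N p m : nat) (A : 'M[R]_(p, N)) b
    (B : 'M[R]_(m, N)) d x y :
  polyhedron A b B d x -> polyhedron A b B d y ->
  polyhedron A b B d (2^-1 *: (x + y)).
Proof.
move=> [xA xB] [yA yB]; split=> [|i].
  rewrite -scalemxAr mulmxDr xA yA -mulr2n -scaler_nat scalerA.
  by rewrite mulVf ?scale1r // pnatr_eq0.
rewrite -scalemxAr mulmxDr; move: (xB i) (yB i).
move: (B *m x) (B *m y) => z w; rewrite !mxE; lra.
Qed.

Section Polyhedron.
Variables (R : realType) (N n p m : nat) (A : 'M[R]_(p, N)) (b : 'cV[R]_p).
Variables (B : 'M[R]_(m, N)) (d : 'cV[R]_m).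
Local Notation P := (polyhedron A b B d).
Hypothesis P_bounded : bounded_set P.
Hypothesis P_dim : has_dim P n.
Hypothesis P_minimal : minimal_representation A b B d.
Local Notation slack := (slack B d).
Local Notation rate := (rate B).
Local Notation tight := (tight B d).

Definition direction : {vspace 'cV[R]_N} := lker (linfun (mulmx A)).
Local Notation L := direction.

Lemma mem_direction g : (g \in L) = (A *m g == 0).
Proof. by rewrite memv_ker lfunE. Qed.

Definition row_facet i : set 'cV[R]_N := [set x | P x /\ slack i x = 0].

Lemma row_facetE i : row_facet i = [set x | P x /\ (B *m x) i 0 = d i 0].
Proof.
apply/seteqP; split=> x [Px xi]; split=> //; last by rewrite slack_def xi subrr.
by rewrite (slackE B d) xi subr0.
Qed.

Lemma row_facet_facet i : is_facet P (row_facet i).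
Proof. by rewrite row_facetE. Qed.

Lemma polyhedron_slack_ge0 i x : P x -> 0 <= slack i x.
Proof. by move=> [_ xB]; rewrite slack_def subr_ge0. Qed.

Lemma row_facet_proper i : exists2 x, P x & 0 < slack i x.
Proof.
have [_ [k [Pk Fk]]] := row_facet_facet i.
have [x Px xi] : exists2 x, P x & slack i x != 0.
  apply/not_exists2P => xi; suff PF : row_facet i = P.
    by rewrite PF in Fk; have := has_dim_inj Pk Fk => /eqP; rewrite eqn_leq ltnn.
  apply/seteqP; split=> [x []//|x Px]; split=> //.
  by apply/eqP/negPn/negP => /(conj Px) []; case: (xi x).
by exists x => //; rewrite lt_def xi polyhedron_slack_ge0.
Qed.

(** The rows are treated one at a time by averaging with a point off the next facet; a midpoint
    keeps positive slacks positive. *)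
Lemma interior_exists : exists2 x, P x & forall i, 0 < slack i x.
Proof.
have [D [_ [x0 Px0] _ _]] := has_dim_direction P_dim.
suff [x Px xi] : exists2 x, P x & forall i, i \in enum 'I_m -> 0 < slack i x.
  by exists x => // i; apply: xi; rewrite mem_enum.
elim: (enum 'I_m) => [|i s [x Px xs]]; first by exists x0.
have [y Py yi] := row_facet_proper i.
have ge0 := polyhedron_slack_ge0.
exists (2^-1 *: (x + y)); first exact: polyhedron_midpoint.
move=> j; rewrite in_cons slack_midpoint => /predU1P[->|/xs js].
  by have := ge0 i x Px; lra.
by have := ge0 j y Py; lra.
Qed.

Lemma polyhedron_frame p0 : P p0 -> (forall i, 0 < slack i p0) ->
  frame P L p0 B d.
Proof.
move=> Pp0 p0_gt0; have inP x : P x <-> x - p0 \in L /\ forall i, 0 <= slack i x.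
  rewrite mem_direction mulmxBr Pp0.1 subr_eq0.
  split=> [[-> xB]|[/eqP xA xB]]; split=> // i; move: (xB i);
    by rewrite slack_def subr_ge0.
split=> // g gL g_ge0; apply/eqP/negPn/negP => g0.
have [M _ PM] := pinfty_ex_gt (num_real 0) P_bounded.
have Pt t : 0 <= t -> P (p0 + t *: g).
  move=> t0; apply/inP; split=> [|i].
    by rewrite addrAC subrr add0r rpredZ.
  by rewrite slackDZ addr_ge0 ?(ltW (p0_gt0 i)) // mulr_ge0.
have g_gt0 : 0 < `|g| by rewrite normr_gt0.
(* At this parameter the ray has norm at least [M + 1]. *)
pose t := (M + `|p0| + 1) / `|g|.
have M0 : 0 <= M by apply: le_trans (PM _ Pp0); rewrite normr_ge0.
have t0 : 0 <= t by rewrite divr_ge0 // !addr_ge0.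
have := PM _ (Pt t t0); apply/negP; rewrite -ltNge.
have := ler_normB (p0 + t *: g) p0.
rewrite addrAC subrr add0r normrZ ger0_norm // /t divfK ?gt_eqF //; lra.
Qed.

Section Interior.
Variable p0 : 'cV[R]_N.
Hypotheses (Pp0 : P p0) (p0_gt0 : forall i, 0 < slack i p0).
Local Notation PF := (polyhedron_frame Pp0 p0_gt0).

Lemma dim_direction : \dim L = n.
Proof.
have [D [<- _ Din DU]] := has_dim_direction P_dim; congr (\dim _).
apply/eqP; rewrite eqEsubv; apply/andP; split.
  apply/subvP => g gL; have [i|a a0 Pa] := small_step PF Pp0 gL.
    by rewrite finset.in_set gt_eqF.
  by have := Din _ _ Pa Pp0; rewrite addrAC subrr add0r rpredZeq gt_eqF.
by apply: DU => x y; exact: (sub_direction PF).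
Qed.

Lemma facet_dim k : has_dim P k.+1 -> \dim L = k.+1.
Proof. by move=> /(has_dim_inj P_dim) <-; exact: dim_direction. Qed.

(** Rows of the same facet are positively proportional on [L]. Their combination [c] vanishes on the
    direction space [D] of the facet and on [p0 - x0], and these span [L] because [D] has
    codimension one. *)
Lemma row_facet_rate i j g : row_facet i = row_facet j -> g \in L ->
  slack j p0 * rate i g = slack i p0 * rate j g.
Proof.
move=> ij; have [_ [k [Pk Fk]]] := row_facet_facet i.
have [D [Dk [x0 Fx0] Din DU]] := has_dim_direction Fk.
pose c := slack j p0 *: row i B - slack i p0 *: row j B.
have cE x : (c *m x) 0 0 = slack i p0 * rate j x - slack j p0 * rate i x.
  rewrite mulmxBl -!scalemxAl -!row_mul !rateE.
  by move: (B *m x) => z; rewrite !mxE; ring.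
have slackF x : row_facet i x -> slack i x = 0 /\ slack j x = 0.
  by move=> Fi; have := Fi; rewrite ij => -[_ xj]; case: Fi.
have rateF x y : row_facet i x -> row_facet i y ->
    rate i (x - y) = 0 /\ rate j (x - y) = 0.
  move=> /slackF[xi xj] /slackF[yi yj].
  have := slackB B d i x y; have := slackB B d j x y.
  by rewrite xi xj yi yj !add0r => <- <-.
have Di : (D <= lker (linfun (mulmx (row i B))))%VS.
  apply: DU => x y Fx Fy; rewrite mem_ker_row -row_mul mxE -oppr_eq0 -rateE.
  by rewrite (rateF x y Fx Fy).1.
have Dc : (D <= lker (linfun (mulmx c)))%VS.
  apply: DU => x y Fx Fy; rewrite mem_ker_row cE.
  by have [-> ->] := rateF x y Fx Fy; rewrite !mulr0 subrr.
have [x0i x0j] := slackF _ Fx0; pose w := p0 - x0.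
have wi : rate i w = slack i p0 by rewrite (slackB B d i p0 x0) x0i add0r.
have wj : rate j w = slack j p0 by rewrite (slackB B d j p0 x0) x0j add0r.
have wD : w \notin D.
  apply/negP => /(subvP Di); rewrite mem_ker_row -row_mul mxE -oppr_eq0 -rateE wi.
  by rewrite gt_eqF.
have DL : (D <= L)%VS.
  by apply: DU => x y [Px _] [Py _]; exact: (sub_direction PF).
have wL : w \in L by case: Fx0 => Px0 _; exact: (sub_direction PF).
have LE : (D + <[w]>)%VS = L.
  apply/eqP; rewrite eqEdim subv_add DL -memvE wL /= (facet_dim Pk) -Dk ltnNge.
  apply: contra wD => dD; suff -> : D = (D + <[w]>)%VS.
    by rewrite (subvP (addvSr _ _)) // memv_line.
  by apply/eqP; rewrite eqEdim addvSl.
rewrite -LE => /memv_addP[y yD [_ /vlineP[a ->] ->]].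
have := subvP Dc _ yD; rewrite mem_ker_row cE subr_eq0 => /eqP yE.
by rewrite !rateD !rateZ wi wj !mulrDr yE; ring.
Qed.

(** At a point of [F] with the fewest tight rows, these rows are tight on all of [F]. There is one,
    since otherwise the functional of [F] would be constant on [P]; its facet contains [F] and has
    the same dimension. *)
Lemma facet_is_row F : is_facet P F -> exists i, F = row_facet i.
Proof.
move=> [Ff [k [Pk Fk]]]; have [D [Dk [x0 Fx0] Din DU]] := has_dim_direction Fk.
have FP : F `<=` P by move: Ff => [c [z [_ ->]]] x [].
pose Q s := `[< exists2 x, F x & #|tight x| = s >].
have exQ : exists s, Q s by exists #|tight x0|; apply/asboolP; exists x0.
case: (ex_minnP exQ) => s /asboolP[f Ff0 fs] smin.
have tight_sub x : F x -> tight f \subset tight x.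
  move=> Fx; have mF : F (2^-1 *: (f + x)).
    have [c [z [_ FE]]] := Ff; move: Ff0 Fx; rewrite FE => -[Pf cf] [Px cx].
    split; first exact: (midpoint_mem PF).
    by rewrite -scalemxAr mulmxDr mxE [X in _ * X]mxE cf cx; field.
  have /smin : Q #|tight (2^-1 *: (f + x))|.
    by apply/asboolP; exists (2^-1 *: (f + x)).
  rewrite (tight_midpoint PF) -?fs; [|exact: FP|exact: FP] => le.
  have /eqP <- : (tight f :&: tight x)%SET == tight f.
    by rewrite eqEcard finset.subsetIl le.
  exact: finset.subsetIr.
have [i fi] : exists i, i \in tight f.
  apply/not_existsP => nf; have [c [z [cz FE]]] := Ff.
  have Pf : P f := FP _ Ff0.
  have cf : (c *m f) 0 0 = z by move: Ff0; rewrite FE => -[].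
  have c_le0 g : g \in L -> (c *m g) 0 0 <= 0.
    move=> gL; have [i /nf//|a a0 /cz] := small_step PF Pf gL.
    by rewrite mulmxDr mxE cf -scalemxAr mxE gerDl pmulr_rle0.
  suff PFE : F = P.
    by rewrite PFE in Fk; have := has_dim_inj Pk Fk => /eqP; rewrite eqn_leq ltnn.
  apply/seteqP; split=> // x Px; rewrite FE; split=> //.
  have := c_le0 (x - f) (sub_direction PF Px Pf).
  rewrite mulmxBr mxE [X in _ + X]mxE cf subr_le0 => xz.
  have := c_le0 (f - x) (sub_direction PF Pf Px).
  rewrite mulmxBr mxE [X in _ + X]mxE cf subr_le0 => zx.
  by apply/eqP; rewrite eq_le xz zx.
exists i; apply: (face_eq_dim Ff) Fk _.
- move=> x Fx; split; first exact: FP.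
  by apply/tightP; apply: (fintype.subsetP (tight_sub x Fx)).
- by move=> x [].
- have [_ [l [Pl Fl]]] := row_facet_facet i.
  by have [->] := has_dim_inj Pk Pl.
Qed.

Lemma row_facet_slack i j x : row_facet i = row_facet j -> x - p0 \in L ->
  slack j p0 * slack i x = slack i p0 * slack j x.
Proof.
move=> ij xL; rewrite (slackB B d i x p0) (slackB B d j x p0) !mulrDr.
by rewrite (row_facet_rate ij xL) mulrC.
Qed.

End Interior.

End Polyhedron.


(** * Edge directions and one row for each facet *)

Lemma corner_edge_dirs (R : realType) (N q : nat) (P : set 'cV[R]_N)
    (L : {vspace 'cV[R]_N}) (C : 'M[R]_(q, N)) (h : 'cV[R]_q) v :
  corner P L C h v -> (#|tight C h v| <= \dim L)%N ->
  #|tight C h v| = \dim L /\ exists e, edge_dirs L C h v e.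
Proof.
move=> [Pv vL]; set T := tight C h v => le_T.
(* The tight rows map [L] injectively at a corner, hence bijectively by the bound on [#|T|].
   Preimages of negated unit vectors are the edge directions, the sign being that of [rate]. *)
pose f : 'Hom('cV[R]_N, 'cV[R]_#|T|) :=
  linfun (mulmx (rowsub (@enum_val _ (mem T)) C)).
have fE g i (iT : i \in T) : rate C i g = - f g (enum_rank_in iT i) 0.
  by rewrite lfunE /= mul_rowsub_mx [in RHS]mxE enum_rankK_in // rateE.
have f_inj : (L :&: lker f)%VS = 0%VS.
  apply/eqP; rewrite -subv0; apply/subvP => g /memv_capP[gL].
  rewrite memv_ker memv0 => /eqP fg; apply/eqP/vL => // i iT.
  by rewrite fE fg mxE oppr0.
have dim_img := limg_dim_eq f_inj.
have dim_le : (\dim L <= #|T|)%N.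
  rewrite -dim_img; apply: leq_trans (dimvS (subvf _)) _.
  by rewrite dimvf /dim /= muln1.
have dimE : #|T| = \dim L by apply/eqP; rewrite eqn_leq le_T.
split=> //.
have imgT : (f @: L)%VS = fullv.
  by apply/eqP; rewrite eqEdim subvf dimvf /dim /= muln1 dim_img dimE leqnn.
have pre i : exists g, i \in T ->
    g \in L /\ forall j, j \in T -> rate C j g = (i == j)%:R.
  have [iT|] := boolP (i \in T); last by exists 0.
  have : - delta_mx (enum_rank_in iT i) 0 \in (f @: L)%VS by rewrite imgT memvf.
  case/memv_imgP => g gL gE; exists g => _; split=> // j jT.
  rewrite fE -gE !mxE opprK eqxx andbT.
  by rewrite -(inj_eq enum_val_inj) !enum_rankK_in // eq_sym.
have [e eP] := choice pre; exists e => i iT; exact: eP.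
Qed.

Section Representatives.
Variables (R : realType) (N n p m : nat) (A : 'M[R]_(p, N)) (b : 'cV[R]_p).
Variables (B : 'M[R]_(m, N)) (d : 'cV[R]_m).
Local Notation P := (polyhedron A b B d).
Hypothesis P_bounded : bounded_set P.
Hypothesis P_dim : has_dim P n.
Hypothesis P_minimal : minimal_representation A b B d.
Hypothesis P_simple : is_simple P.
Local Notation L := (direction A).
Local Notation row_facet := (row_facet A b B d).

(** Several rows may define the same facet. One is kept for each, so that counting rows counts
    facets; the choice by [pick] depends only on the facet. *)
Lemma facet_representatives : exists (q : nat) (f : 'I_q -> 'I_m),
  injective (fun i => row_facet (f i)) /\
  forall k, exists i, row_facet k = row_facet (f i).
Proof.
pose rep k := odflt k [pick j | `[< row_facet j = row_facet k >]].
have repP k : row_facet (rep k) = row_facet k.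
  by rewrite /rep; case: pickP => [j /asboolP|/(_ k)/asboolP].
have rep_eq k l : row_facet k = row_facet l -> rep k = rep l.
  move=> kl; rewrite /rep kl; case: pickP => // /(_ l)/asboolP; exact.
pose S := [set rep k | k in 'I_m]%SET.
exists #|S|, (@enum_val _ (mem S)); split=> [i j ij|k].
  apply: enum_val_inj.
  have /imsetP[k _ kE] := enum_valP i; have /imsetP[l _ lE] := enum_valP j.
  by rewrite kE lE; apply: rep_eq; rewrite -(repP k) -kE ij lE repP.
have kS : rep k \in S by exact: imset_f.
by exists (enum_rank_in kS (rep k)); rewrite enum_rankK_in // repP.
Qed.

Section Frame.
Variables (q : nat) (f : 'I_q -> 'I_m) (p0 : 'cV[R]_N).
Hypothesis f_inj : injective (fun i => row_facet (f i)).
Hypothesis f_onto : forall k, exists i, row_facet k = row_facet (f i).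
Hypotheses (Pp0 : P p0) (p0_gt0 : forall i, 0 < slack B d i p0).
Local Notation PF := (polyhedron_frame P_bounded Pp0 p0_gt0).
Local Notation C := (rowsub f B).
Local Notation h := (rowsub f d).

Lemma rate_rowsub i g : rate C i g = rate B (f i) g.
Proof. by rewrite !rateE mul_rowsub_mx mxE. Qed.

Lemma slack_rowsub i x : slack C h i x = slack B d (f i) x.
Proof. by rewrite !slack_def mul_rowsub_mx mxE [X in _ - X]mxE. Qed.

(** A dropped inequality is a positive multiple of a kept one on the affine hull of [P]. *)
Lemma rowsub_frame : frame P L p0 C h.
Proof.
split=> [x|i|g gL g_ge0].
- split=> [Px|[xL x_ge0]].
    split=> [|i]; first exact: (sub_direction PF).
    by rewrite slack_rowsub (slack_ge0 PF).
  apply/(frameE PF); split=> // k; have [i ki] := f_onto k.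
  have := row_facet_slack P_bounded P_dim P_minimal Pp0 p0_gt0 ki xL.
  move=> E; rewrite -(pmulr_rge0 _ (p0_gt0 (f i))) E mulr_ge0 ?(ltW (p0_gt0 _)) //.
  by rewrite -slack_rowsub.
- by rewrite slack_rowsub.
- apply: (frame_bounded PF) => // k; have [i ki] := f_onto k.
  have E := row_facet_rate P_bounded P_dim P_minimal Pp0 p0_gt0 ki gL.
  rewrite -(pmulr_rge0 _ (p0_gt0 (f i))) E mulr_ge0 ?(ltW (p0_gt0 _)) //.
  by rewrite -rate_rowsub.
Qed.

Lemma card_facets : [set F | is_facet P F] #= `I_q.
Proof.
have -> : [set F | is_facet P F] = (fun i => row_facet (f i)) @` [set: 'I_q].
  apply/seteqP; split=> F /=; last by move=> [i _ <-]; exact: row_facet_facet.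
  move=> /(facet_is_row P_bounded P_minimal Pp0 p0_gt0)[k ->].
  by have [i ->] := f_onto k; exists i.
apply: (card_eq_trans (inj_card_eq _)) => [i j _ _ /f_inj //|].
by rewrite card_eq_sym card_II.
Qed.

Lemma card_tight_le v : is_vertex P v -> (#|tight C h v| <= n)%N.
Proof.
move=> vv; have [n' [Pn' /(_ v vv) Fv]] := P_simple.
rewrite (has_dim_inj P_dim Pn'); set T := tight C h v.
have Pv : P v by exact: vertex_mem PF _ vv.
rewrite -card_le_II -(card_le_eqr Fv) (card_le_eql card_II).
pose F (i : 'I_#|T|) := row_facet (f (enum_val i)).
have /card_esym FI : F @` [set: 'I_#|T|] #= [set: 'I_#|T|].
  by apply: inj_card_eq => i j _ _ /f_inj/enum_val_inj.
rewrite (card_le_eql FI); apply: subset_card_le => _ [i _ <-]; split.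
  exact: row_facet_facet.
by split=> //; rewrite -slack_rowsub; apply/tightP/enum_valP.
Qed.

Lemma rowsub_simple_frame : simple_frame n P L p0 C h.
Proof.
have dimL := dim_direction P_bounded P_dim Pp0 p0_gt0.
have corner_card v : corner P L C h v -> (#|tight C h v| <= \dim L)%N.
  by rewrite dimL => /(vertexP rowsub_frame); exact: card_tight_le.
split=> [|v cv|v cv|i].
- exact: rowsub_frame.
- by rewrite -dimL; have [] := corner_edge_dirs cv (corner_card v cv).
- by have [] := corner_edge_dirs cv (corner_card v cv).
- have [_ [k [_ Fk]]] := row_facet_facet P_minimal (f i).
  have [D [_ [x [Px xi]] _ _]] := has_dim_direction Fk.
  by exists x => //; rewrite slack_rowsub.
Qed.

(** On [L] a dropped row vanishes exactly where its representative does, so inclusions of supports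
    are unchanged. *)
Lemma min_supp_rowsub g : min_supp B L g <-> min_supp C L g.
Proof.
have sub x y : x \in L -> y \in L ->
    (supp (B *m x) \subset supp (B *m y)) = (supp (C *m x) \subset supp (C *m y)).
  move=> xL yL; rewrite !supp_rate_sub.
  apply/forallP/forallP => xy i; first by rewrite !rate_rowsub.
  have [j ij] := f_onto i; move: (xy j); rewrite !rate_rowsub.
  suff E0 z : z \in L -> (rate B i z == 0) = (rate B (f j) z == 0) by rewrite !E0.
  move=> zL; have := row_facet_rate P_bounded P_dim P_minimal Pp0 p0_gt0 ij zL.
  by move=> /(congr1 (eq_op^~ 0)); rewrite !mulf_eq0 !(gt_eqF (p0_gt0 _)).
by split=> -[gL g0 gmin]; split=> // x xL x0; have := gmin x xL x0;
  rewrite !properE !sub.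
Qed.

End Frame.
End Representatives.


(** * Circuits as vectors of minimal support *)

Lemma coprime_multiple (N : nat) (x : 'cV[rat]_N) : x != 0 ->
  exists (t : rat) (z : 'cV[int]_N), [/\ 0 < t, map_mx intr z = t *: x
    & \big[gcdn/0%N]_(i < N) `|z i ord0|%N = 1%N].
Proof.
move=> x0; pose D := \prod_(j < N) denq (x j 0).
pose y i : int := numq (x i 0) * \prod_(j < N | j != i) denq (x j 0).
have D_gt0 : 0 < D by apply: prodr_gt0 => j _; exact: denq_gt0.
have yE i : (y i)%:~R = D%:~R * x i 0 :> rat.
  rewrite /y /D [in RHS](bigD1 i) //= !intrM numqE; ring.
pose G := \big[gcdn/0%N]_(i < N) `|y i|%N.
have Gy i : (G %| `|y i|)%N by apply: (biggcdn_inf i).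
have G_gt0 : (0 < G)%N.
  rewrite lt0n; apply: contraNneq x0 => G0; apply/eqP/colP => i.
  have := Gy i; rewrite G0 dvd0n absz_eq0 => /eqP yi0.
  have := yE i; rewrite yi0 mxE => /esym/eqP; rewrite mulf_eq0 intr_eq0 gt_eqF //=.
  by move=> /eqP.
have GyZ i : (y i %/ G%:Z)%Z * G%:Z = y i by apply/divzK; rewrite dvdzE.
exists (D%:~R / G%:R), (\col_i (y i %/ G%:Z)%Z); split.
- by rewrite divr_gt0 ?ltr0z ?ltr0n.
- apply/colP => i; rewrite !mxE.
  have G0 : G%:R != 0 :> rat by rewrite pnatr_eq0 -lt0n.
  apply: (mulIf G0); rewrite mulrAC divfK // -yE -[in RHS](GyZ i) intrM.
  by rewrite -pmulrn.
(* The product of [G'] and [G] divides every [y i], hence divides [G]. *)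
set G' := \big[gcdn/0%N]_(i < N) _.
apply/eqP; rewrite -dvdn1 -(dvdn_pmul2r G_gt0) mul1n.
apply/dvdn_biggcdP => i _; rewrite -(GyZ i) abszM absz_nat dvdn_pmul2r //.
by rewrite /G' (biggcdn_inf i) // mxE.
Qed.

(** The rank of a rational matrix is the same over the reals. *)
Lemma rational_kernel (R : realType) (N p : nat) (M : 'M[rat]_(p, N))
    (g : 'cV[R]_N) :
  map_mx ratr M *m g = 0 -> g != 0 -> exists2 x : 'cV[rat]_N, x != 0 & M *m x = 0.
Proof.
move=> Mg g0; have : ~~ row_free M^T.
  rewrite /row_free -(mxrank_map (ratr : rat -> R)) -/(row_free _).
  apply: contra g0 => free_M; rewrite -trmx_eq0 -(mulmx_free_eq0 _ free_M).
  by rewrite -map_trmx -trmx_mul Mg trmx0.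
rewrite -kermx_eq0 => /rowV0Pn [x /sub_kermxP xM x0].
exists x^T; first by rewrite trmx_eq0.
by apply: trmx_inj; rewrite trmx_mul trmxK xM trmx0.
Qed.

Section Circuits.
Variables (R : realType) (N p m : nat) (A : 'M[rat]_(p, N)) (B : 'M[rat]_(m, N)).
Local Notation AR := (map_mx ratr A : 'M[R]_(p, N)).
Local Notation BR := (map_mx ratr B : 'M[R]_(m, N)).
Local Notation L := (direction AR).

Lemma circuit_min_supp (g : 'cV[R]_N) : is_circuit A B g -> min_supp BR L g.
Proof.
move=> [Ag g0 _ gmin]; split=> // [|x]; rewrite mem_direction; first exact/eqP.
by move=> /eqP; exact: gmin.
Qed.

(* A vector of minimal support is determined up to a scalar by the zero pattern
   of [B g], which cuts out a rational subspace. *)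
Lemma min_supp_circuit (P : set 'cV[R]_N) p0 h (g : 'cV[R]_N) :
  frame P L p0 BR h -> min_supp BR L g ->
  exists2 c : R, 0 < c & is_circuit A B (c *: g).
Proof.
move=> PF [gL g0 gmin].
(* The rows of [B] on which [g] vanishes, the others being replaced by zero. *)
pose BZ : 'M[rat]_(m, N) := \matrix_(i, j) (B i j *+ (rate BR i g == 0)).
have BZE (F : fieldType) (r : {rmorphism rat -> F}) (x : 'cV[F]_N) i :
    (map_mx r BZ *m x) i 0 = (map_mx r B *m x) i 0 *+ (rate BR i g == 0).
  rewrite !mxE -sumrMnl; apply: eq_bigr => j _.
  by rewrite !mxE raddfMn mulrnAl.
have [||x x0] := @rational_kernel R N _ (col_mx A BZ) g.
- rewrite map_col_mx mul_col_mx; move: gL; rewrite mem_direction => /eqP ->.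
  rewrite (_ : map_mx _ BZ *m g = 0) ?col_mx0 //; apply/colP => i.
  rewrite BZE [RHS]mxE; have [i0|//] := eqVneq (rate BR i g) 0.
  by apply: oppr_inj; rewrite -rateE i0 oppr0.
- by [].
rewrite mul_col_mx -[0]col_mx0 => /eq_col_mx[Ax Bx].
pose y : 'cV[R]_N := map_mx ratr x.
have y0 : y != 0 by rewrite map_mx_eq0.
have yL : y \in L by rewrite mem_direction -map_mxM Ax map_mx0.
have y_rate i : rate BR i g = 0 -> rate BR i y = 0.
  move=> /eqP gi; have := BZE _ (ratr : {rmorphism rat -> R}) y i.
  by rewrite gi -map_mxM Bx map_mx0 mulr1n rateE => <-; rewrite mxE oppr0.
have [k gk] : exists k, rate BR k g != 0.
  apply/not_existsP => gk; case/eqP: g0; apply: (frame_bounded PF) => // i.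
  by have /negP := gk i; rewrite negbK => /eqP ->.
(* The difference is supported within [g] and vanishes on [k], so by minimality it is zero. *)
have yg : rate BR k g *: y = rate BR k y *: g.
  apply/eqP; rewrite -subr_eq0; apply/negPn/negP => z0.
  have := gmin _ _ z0; rewrite rpredB ?rpredZ // => /(_ isT)/negP; apply.
  rewrite properE !supp_rate_sub; apply/andP; split.
    apply/forallP => i; apply/implyP => /eqP gi.
    by rewrite rateB !rateZ gi y_rate // !mulr0 subrr.
  apply/negP => /forallP/(_ k); rewrite rateB !rateZ mulrC subrr eqxx /=.
  by rewrite (negPf gk).
have yk : rate BR k y != 0.
  apply: contraNneq y0 => yk; move/eqP: yg; rewrite yk scale0r scaler_eq0.
  by rewrite (negPf gk).
pose a := rate BR k y / rate BR k g.
have yE : y = a *: g.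
  by apply: (scalerI gk); rewrite yg scalerA mulrCA mulfV ?mulr1.
have a0 : a != 0 by rewrite mulf_neq0 // invr_eq0.
have [t [z [t0 zE gcdz]]] := coprime_multiple x0.
have zR : map_mx intr z = (ratr t * a) *: g :> 'cV[R]_N.
  rewrite -scalerA -yE -map_mxZ -zE -map_mx_comp; apply/colP => i.
  by rewrite !mxE /= ratr_int.
have tR : 0 < ratr t :> R by rewrite ltr0q.
have circ c (z' : 'cV[int]_N) : c != 0 -> map_mx intr z' = c *: g ->
    \big[gcdn/0%N]_(i < N) `|z' i ord0|%N = 1%N -> is_circuit A B (c *: g).
  move=> c0 z'E z'gcd; split.
  - by apply/eqP; rewrite -mem_direction rpredZ.
  - by rewrite scaler_eq0 negb_or c0.
  - by exists z'.
  move=> w Aw w0; have wL : w \in L by rewrite mem_direction Aw.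
  have -> : supp (BR *m (c *: g)) = supp (BR *m g); last exact: gmin.
  by apply/setP => i; rewrite !supp_rate rateZ mulf_eq0 (negPf c0).
(* The sign of [a] decides whether [z] or [- z] is a positive multiple of [g]. *)
have [a_gt|a_lt|aE] := ltgtP a 0; last by rewrite aE eqxx in a0.
  exists (- (ratr t * a)); first by rewrite oppr_gt0 pmulr_rlt0.
  apply: (circ _ (- z)).
  - by rewrite oppr_eq0 mulf_neq0 // gt_eqF.
  - by rewrite map_mxN zR scaleNr.
  - by rewrite -[RHS]gcdz; apply: eq_bigr => i _; rewrite mxE abszN.
exists (ratr t * a); first by rewrite mulr_gt0.
by apply: (circ _ z) => //; rewrite mulf_neq0 // gt_eqF.
Qed.

End Circuits.


(** * Circuit steps and edges *)

Section EdgeStep.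
Variables (R : realType) (N q n : nat) (P : set 'cV[R]_N).
Variables (L : {vspace 'cV[R]_N}) (p : 'cV[R]_N).
Variables (C : 'M[R]_(q, N)) (h : 'cV[R]_q).
Hypothesis SF : simple_frame n P L p C h.
Implicit Types (i j k : 'I_q) (v u g : 'cV[R]_N) (a : R).

Local Notation slack := (slack C h).
Local Notation rate := (rate C).
Local Notation tight := (tight C h).
Local Notation corner := (corner P L C h).
Local Notation PF := (simple_is_frame SF).

(** The segment is the face of the tight rows other than [i]: its points are [v] plus multiples of
    [e i], limited by the slacks of [i] and [k]. *)
Lemma pivot_edge v e i u k : corner v -> edge_dirs L C h v e -> i \in tight v ->
  pivot P L C h v (e i) i u k -> is_edge P (segment v u).
Proof.
move=> cv ve iv [kv k_lt cu uE [a a0 uEa]].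
have [Pv vL] := cv; have [Pu _] := cu.
have ku : slack k u = 0 by apply/tightP; rewrite uE setU11.
have segE : segment v u = tight_face P C h (tight v :\ i).
  apply/seteqP; split=> x.
    move=> [t /andP[t0 t1] ->].
    have -> : (1 - t) *: v + t *: u = v + (t * a) *: e i.
      by rewrite uEa scalerDr scalerA addrA -scalerDl subrK scale1r.
    have sE j : slack j (v + (t * a) *: e i) = (1 - t) * slack j v + t * slack j u.
      by rewrite uEa !slackDZ; ring.
    split=> [|j /setD1P[ji jv]].
      apply: (translate_mem PF) => // [|j].
        by rewrite rpredZ // (edge_dir_mem ve).
      by rewrite sE addr_ge0 // mulr_ge0 ?subr_ge0 // (slack_ge0 PF).
    rewrite slackDZ (tightP _ _ _ _ jv) (edge_dir_rate ve iv jv) eq_sym (negPf ji).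
    by rewrite mulr0 addr0.
  move=> [Px xT]; have xvL : x - v \in L by exact: (sub_direction PF).
  have rx j : j \in tight v -> rate j (x - v) = slack j x.
    by move=> jv; rewrite (slackB C h j x v) (tightP _ _ _ _ jv) add0r.
  have xvE : x - v = slack i x *: e i.
    rewrite {1}(dirs_expand cv ve xvL) (bigD1 i) //= rx // big1 ?addr0 //.
    by move=> j /andP[jv ji]; rewrite rx // xT ?scale0r // in_setD1 ji.
  have xi := slack_ge0 PF i Px; have xk := slack_ge0 PF k Px.
  exists (slack i x / a).
    rewrite divr_ge0 ?(ltW a0) //= ler_pdivrMr // mul1r.
    move: ku xk; rewrite uEa slackDZ (slackB C h k x v) xvE rateZ; nra.
  rewrite uEa scalerDr scalerA divfK ?gt_eqF // addrA -scalerDl subrK scale1r.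
  by rewrite -xvE addrC subrK.
split; first by rewrite segE; exact: tight_face_face PF _.
have uvE : u - v = a *: e i by rewrite uEa addrAC subrr add0r.
exists v, [tuple u - v]; split.
- by exists 0; rewrite ?lexx ?ler01 // subr0 scale1r scale0r addr0.
- by rewrite seq1_free uvE scaler_eq0 gt_eqF // (edge_dir_neq0 ve iv).
- move=> j; rewrite ord1 (tnth_nth 0) /= addrC subrK.
  by exists 1; rewrite ?lexx ?ler01 // subrr scale0r scale1r add0r.
- move=> _ [t _ ->]; rewrite span_seq1; apply/vlineP; exists t.
  by rewrite uEa; apply/colP => j; rewrite !mxE; ring.
Qed.

(** Only one tight rate of [g] is positive, so [g] is a positive multiple of some [e i] and its
    maximal step is a pivot. *)
Lemma edge_step v g a : feasible_along_edges P L C h -> corner v ->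
  min_supp C L g -> 0 < a -> P (v + a *: g) ->
  (forall b, a < b -> ~ P (v + b *: g)) ->
  corner (v + a *: g) /\ is_edge P (segment v (v + a *: g)).
Proof.
move=> along cv gmin a0 Pa amax; have [e ve] := simple_dirs SF cv.
have [Pv vL] := cv; have [gL g0 _] := gmin.
have g_in i : i \in tight v -> 0 <= rate i g by exact: (feasible_rate PF Pa a0).
have [i [iv gi]] : exists i, i \in tight v /\ 0 < rate i g.
  apply/not_existsP => ng; case/eqP: g0; apply: vL => // i iv; apply/eqP.
  rewrite eq_le g_in // andbT leNgt; apply/negP => gi; exact: (ng i).
have gE : g = rate i g *: e i.
  rewrite {1}(dirs_expand cv ve gL) (bigD1 i) //= big1 ?addr0 // => j /andP[jv ji].
  have [gj|gj] := ltP 0 (rate j g).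
    by rewrite (along v g cv gmin g_in j i) // eqxx in ji.
  suff -> : rate j g = 0 by rewrite scale0r.
  by apply/eqP; rewrite eq_le gj g_in.
have [u [k vuk]] := pivot_exists SF cv ve iv.
suff <- : u = v + a *: g by split; [case: vuk|exact: pivot_edge vuk].
have [kv k_lt cu uE [c c0 uEc]] := vuk.
have ku : slack k u = 0 by apply/tightP; rewrite uE setU11.
rewrite gE scalerA uEc; congr (_ + _ *: _); apply/eqP; rewrite eq_le.
apply/andP; split.
  rewrite -ler_pdivrMr // leNgt; apply/negP => /amax; apply.
  by rewrite {2}gE scalerA divfK ?gt_eqF // -uEc; case: cu.
have := slack_ge0 PF k Pa; rewrite {1}gE scalerA slackDZ.
move: ku; rewrite uEc slackDZ; nra.
Qed.

(** If [g] left both [i] and [j], a small step along [e i] would stay in every face containing the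
    segment, hence in the segment itself. Then [e i] would be parallel to [g], but it has rate zero
    on [j]. *)
Lemma edge_feasible_along v g a : corner v -> g \in L -> 0 < a ->
  P (v + a *: g) -> is_face P (segment v (v + a *: g)) ->
  forall i j, i \in tight v -> j \in tight v ->
    0 < rate i g -> 0 < rate j g -> i = j.
Proof.
move=> cv gL a0 Pa Gf i j iv jv gi gj; apply/eqP/negPn/negP => ij.
have [Pv _] := cv; have [e ve] := simple_dirs SF cv.
have seg_v : segment v (v + a *: g) v.
  by exists 0; rewrite ?lexx ?ler01 // subr0 scale1r scale0r addr0.
have seg_a : segment v (v + a *: g) (v + a *: g).
  by exists 1; rewrite ?lexx ?ler01 // subrr scale0r scale1r add0r.
have [|c c0 Pc] := small_step PF Pv (edge_dir_mem ve iv).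
  by move=> l lv; rewrite (edge_dir_rate ve iv lv) ler0n.
have : segment v (v + a *: g) (v + c *: e i).
  apply: (tight_face_sub_face PF Gf seg_v seg_a); split=> // l /setIP[lv].
  move=> /tightP; rewrite !slackDZ (tightP _ _ _ _ lv) !add0r.
  move=> /eqP; rewrite mulf_eq0 gt_eqF //= => lg.
  rewrite (edge_dir_rate ve iv lv); have [il|_] := eqVneq i l.
    by rewrite -il gt_eqF in lg.
  by rewrite mulr0.
move=> [t _ cE]; have {}cE : c *: e i = (t * a) *: g.
  by apply: (addrI v); rewrite cE scalerDr scalerA addrA -scalerDl subrK scale1r.
have := congr1 (rate j) cE.
rewrite !rateZ (edge_dir_rate ve iv jv) (negPf ij) mulr0.
move/esym/eqP; rewrite mulf_eq0 [rate j g == 0]gt_eqF // orbF => /eqP ta0.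
move/eqP: cE; rewrite ta0 scale0r scaler_eq0 gt_eqF //=.
by rewrite (negPf (edge_dir_neq0 ve iv)).
Qed.

End EdgeStep.

Theorem theorem7 (R : realType) (N n p m : nat)
    (A : 'M[rat]_(p, N)) (b : 'cV[R]_p) (B : 'M[rat]_(m, N)) (d : 'cV[R]_m)
    (P : set 'cV[R]_N)
    (n_gt0 : (0 < n)%N)
    (P_def : P = polyhedron (map_mx ratr A) b (map_mx ratr B) d)
    (P_polytope : bounded_set P)
    (P_dim : has_dim P n)
    (P_simple : is_simple P)
    (P_minimal :
       minimal_representation (map_mx ratr A) b (map_mx ratr B) d) :
  (forall (v1 v2 : 'cV[R]_N) (k : nat) (y : nat -> 'cV[R]_N),
     circuit_walk A B P v1 v2 k y -> edge_walk P k y)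
  <-> exists e : nat, (1 <= e <= n)%N /\ nd_parallelotope n e P.
Proof.
subst P; set AR := map_mx ratr A in P_polytope P_dim P_simple P_minimal *.
set BR := map_mx ratr B in P_polytope P_dim P_simple P_minimal *.
set P := polyhedron AR b BR d in P_polytope P_dim P_simple P_minimal *.
have [p0 Pp0 p0_gt0] := interior_exists P_dim P_minimal.
have PF := polyhedron_frame P_polytope Pp0 p0_gt0.
have [q [f [f_inj f_onto]]] := facet_representatives AR b BR d.
have SF := rowsub_simple_frame P_polytope P_dim P_minimal P_simple f_inj f_onto
  Pp0 p0_gt0.
have msP g := min_supp_rowsub P_polytope P_dim P_minimal f_onto Pp0 p0_gt0 g.
set C := rowsub f BR in SF msP; set h := rowsub f d in SF msP.
have CF := simple_is_frame SF.
split=> [walks|[e [_ [_ _ _ sym _]]]].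
  have nonpos : nonpos_rates P (direction AR) C h.
    apply: (along_edges_nonpos SF) => v g cv gmin g_in i j iv jv gi gj.
    have [c c0 cg] := min_supp_circuit PF ((msP g).2 gmin).
    have [gL g0 _] := gmin; have [Pv _] := cv.
    have cgL : c *: g \in direction AR by rewrite rpredZ.
    have [||a [k [a0 Pa k_lt k0]]] := max_step CF Pv cgL.
    - by rewrite scaler_eq0 gt_eqF.
    - by move=> l lv; rewrite rateZ mulr_ge0 ?g_in // ltW.
    (* A circuit walk has to end at a vertex, so the maximal step along [c *: g] is continued to
       one; the hypothesis is then applied to the first step. *)
    have [l [y [y0 yl yP ystep]]] := corner_walk PF
      (fun g' g'min => min_supp_circuit PF g'min) Pa.
    pose y' i := if i is i'.+1 then y i' else v.
    have : circuit_walk A B P v (y l) l.+1 y'.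
      split=> // [|[//|t] /yP //|[_|t tl]].
      - by split; [exact/(vertexP CF)|exact/(vertexP PF)].
      - exists (c *: g), a; split=> //.
        exact: (max_step_maximal CF k_lt k0).
      - exact: ystep.
    move=> /walks[_ /(_ 0%N isT)]; rewrite /= y0 => -[Gf _].
    apply: (edge_feasible_along SF cv cgL a0 Pa Gf) => //.
    - by rewrite rateZ mulr_gt0.
    - by rewrite rateZ mulr_gt0.
  have /andP[n_lt_q q_le] := nonpos_card SF nonpos n_gt0.
  (* The dimension of the parallelotopes is the number of facets that miss a given vertex. *)
  exists (q - n)%N; split; first by rewrite subn_gt0 n_lt_q leq_subLR.
  split=> //.
  - by split=> //; exists p, m, AR, b, BR, d.
  - rewrite subnKC ?(ltnW n_lt_q) //.
    exact: (card_facets P_polytope P_minimal f_inj f_onto Pp0 p0_gt0).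
  - exact: (nonpos_symmetric SF).
  - exact: (nonpos_parallelotope SF).
have along := nonpos_along_edges SF (symmetric_nonpos SF sym).
move=> v1 v2 k y [[v1v _] [y0 _] yP ystep].
(* A maximal circuit step from a corner runs along an edge to another corner, so all points of the
   walk are corners by induction. *)
have step i : (i < k)%N -> corner P (direction AR) C h (y i) ->
    corner P (direction AR) C h (y i.+1) /\ is_edge P (segment (y i) (y i.+1)).
  move=> ik ci; have [g [a [cg a0 yE amax]]] := ystep i ik.
  rewrite yE; apply: (edge_step SF along ci) => //.
    exact/msP/circuit_min_supp.
  by rewrite -yE; exact: yP.
have cy i : (i <= k)%N -> corner P (direction AR) C h (y i).
  elim: i => [_|i IHi ik]; first by rewrite y0; exact/(vertexP CF).
  by have [] := step i ik (IHi (ltnW ik)).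
split=> i ik; first exact/(vertexP CF)/cy.
by have [] := step i ik (cy i (ltnW ik)).
Qed.
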